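(* Let $\mathcal{A}$ be an acyclic cluster algebra of geometric type of rank $n$, and let $\Sigma$ be an acyclic seed of $\mathcal{A}$. Then $\{\tilde{x}_\Sigma[\mathbf{a}]\}_{\mathbf{a}\in\mathbb{Z}^n}$ form a $\mathbb{ZP}$-basis of $\mathcal{A}$.
   Context: Seeds and mutation. Let $m\ge n\ge 1$ be integers, $\mathcal{F}=\mathbb{Q}(x_1,\dots,x_m)$, $[a]_+=\max(0,a)$. A seed of rank $n$ is a pair $\Sigma=(\tilde{\mathbf{x}},\tilde{B})$ where $\tilde{\mathbf{x}}=\{x_1,\dots,x_m\}$ is an $m$-tuple of elements of $\mathcal{F}$ forming a free generating set, and $\tilde{B}=(b_{ij})$ is an $m\times n$ integer matrix whose top $n\times n$ submatrix $B$ (the principal part) is sign-skew-symmetric: for all $i,j\le n$ either $b_{ij}=b_{ji}=0$ or $b_{ij},b_{ji}$ have opposite signs. For $1\le k\le n$, the mutation $\mu_k(\tilde{\mathbf{x}},\tilde{B})=(\tilde{\mathbf{x}}',\tilde{B}')$ is given by $x_i'=x_i$ for $i\ne k$, $x_k'=x_k^{-1}\big(\prod_{i=1}^m x_i^{[b_{ik}]_+}+\prod_{i=1}^m x_i^{[-b_{ik}]_+}\big)$, and $b_{ij}'=-b_{ij}$ if $i=k$ or $j=k$, $b'_{ij}=b_{ij}+\frac{|b_{ik}|b_{kj}+b_{ik}|b_{kj}|}{2}$ otherwise. It is well-defined if the principal part of $\tilde{B}'$ is again sign-skew-symmetric. A seed is totally mutable if every sequence of mutations from it consists of well-defined ones;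 two seeds are mutation-equivalent if related by a sequence of well-defined mutations. Cluster algebras. Put $\mathbb{ZP}=\mathbb{Z}[x_{n+1}^{\pm1},\dots,x_m^{\pm1}]$ (the variables $x_{n+1},\dots,x_m$ are never mutated). The cluster of a seed is $\{x_1,\dots,x_n\}$. Given a totally mutable initial seed, the cluster algebra $\mathcal{A}$ of geometric type is the subring of $\mathcal{F}$ generated over $\mathbb{ZP}$ by all clusters of all seeds mutation-equivalent to the initial one; these seeds are the seeds of $\mathcal{A}$. A seed is acyclic if the digraph $Q_B$ on vertices $1,\dots,n$, with exactly one arrow $i\to j$ whenever $b_{ij}>0$, has no oriented cycles. $\mathcal{A}$ is acyclic if it has an acyclic seed. The elements $\tilde{x}_\Sigma[\mathbf{a}]$. Fix the seed $\Sigma=(\{x_1,\dots,x_m\},\tilde{B})$. Extend $\tilde B$ by $b_{ij}=-b_{ji}$ for $1\le i\le n<j\le m$ and $b_{ij}=0$ for $i,j>n$. Let $Q_{\tilde{B}}=\{(i,j): 1\le i,j\le m,\ b_{ij}>0\}$ and identify $Q_B$ with $\{(i,j): 1\le i,j\le n,\ b_{ij}>0\}$. For finite $\{0,1\}$-sequences $t=(t_1,\dots,t_a)$, $t'=(t'_1,\dots,t'_b)$ put $\bar{t}=(1-t_1,\dots,1-t_a)$, $|t|=\sum_r t_r$, $t\cdot t'=\sum_{r=1}^{\min(a,b)}t_rt'_r$, and $\overline{()}=()$. For $\mathbf{a}=(a_1,\dots,a_n)\in\mathbb{Z}^n$ let $S_{\rm all}$ be the set of all $\mathbf{s}=(\mathbf{s}_1,\dots,\mathbf{s}_n)$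 with $\mathbf{s}_i\in\{0,1\}^{[a_i]_+}$, and $S_{\rm gcc}=\{\mathbf{s}\in S_{\rm all}: \mathbf{s}_i\cdot\bar{\mathbf{s}}_j=0\text{ for every }(i,j)\in Q_B\}$. By convention $a_i=0$, $\mathbf{s}_i=()$ for $i>n$. Then $$\tilde{x}_\Sigma[\mathbf{a}]=\Big(\prod_{l=1}^n x_l^{-a_l}\Big)\sum_{\mathbf{s}\in S_{\rm gcc}}\ \prod_{(i,j)\in Q_{\tilde{B}}}x_i^{b_{ij}|\bar{\mathbf{s}}_j|}x_j^{-b_{ji}|\mathbf{s}_i|}.$$ *)

(* Defs.v *)
From mathcomp Require Import all_boot all_order all_algebra.
From mathcomp Require Import mpoly.

Set Implicit Arguments.
Unset Strict Implicit.
Unset Printing Implicit Defensive.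

Import Order.TTheory GRing.Theory Num.Theory.
Local Open Scope ring_scope.

(* Throughout, n is the rank and k the number of frozen variables, so that the
   m >= n of the mathematics is n + k. Mutable indices are lshift k i with
   i : 'I_n, frozen indices are rshift n j with j : 'I_k. *)

Notation ratfun m := {fraction {mpoly rat[m]}}.

Definition evalQ m (x : 'I_m -> ratfun m) (p : {mpoly rat[m]}) : ratfun m :=
  mmap (fun c : rat => tofrac (mpolyC m c)) x p.

(* x is algebraically independent over Q, and Q(x) is the whole field. *)
Definition free_generating m (x : 'I_m -> ratfun m) : Prop :=
  (forall p : {mpoly rat[m]}, evalQ x p = 0 -> p = 0) /\
  (forall z : ratfun m, exists p q : {mpoly rat[m]},
      evalQ x q != 0 /\ z = evalQ x p / evalQ x q).

Definition pos (z : int) : int := Num.max 0 z.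

Definition principal n k (B : 'M[int]_(n + k, n)) : 'M[int]_n := usubmx B.

Definition sign_skew_symmetric n (B : 'M[int]_n) : Prop :=
  forall i j : 'I_n,
    [\/ B i j = 0 /\ B j i = 0, 0 < B i j /\ B j i < 0 | B i j < 0 /\ 0 < B j i].

(* Bare data of a labeled seed; the axioms are in is_seed. *)
Record preseed (n k : nat) := Preseed {
  svar : {ffun 'I_(n + k) -> ratfun (n + k)};
  smat : 'M[int]_(n + k, n)
}.

Definition is_seed n k (S : preseed n k) : Prop :=
  free_generating (svar S) /\ sign_skew_symmetric (principal (smat S)).

(* The sum divided by 2 is always even, so the integer quotient is exact. *)
Definition mut_mat n k (l : 'I_n) (B : 'M[int]_(n + k, n)) :
    'M[int]_(n + k, n) :=
  \matrix_(i, j)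
    if (i == lshift k l) || (j == l) then - B i j
    else B i j + ((`|B i l| * B (lshift k l) j
                   + B i l * `|B (lshift k l) j|) %/ 2)%Z.

Definition mut_var n k (l : 'I_n) (S : preseed n k) :
    {ffun 'I_(n + k) -> ratfun (n + k)} :=
  [ffun i => if i == lshift k l then
      (svar S i)^-1 * (\prod_j svar S j ^ pos (smat S j l)
                       + \prod_j svar S j ^ pos (- smat S j l))
    else svar S i].

Definition mutate n k (S : preseed n k) (l : 'I_n) : preseed n k :=
  Preseed (mut_var l S) (mut_mat l (smat S)).

Definition mutates n k (S : preseed n k) (ls : seq 'I_n) : preseed n k :=
  foldl (@mutate n k) S ls.

Fixpoint well_defined n k (S : preseed n k) (ls : seq 'I_n) : Prop :=
  if ls is l :: ls' then
    sign_skew_symmetric (principal (smat (mutate S l))) /\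
    well_defined (mutate S l) ls'
  else True.

Definition totally_mutable n k (S : preseed n k) : Prop :=
  forall ls : seq 'I_n, well_defined S ls.

Definition mutation_equivalent n k (S S' : preseed n k) : Prop :=
  exists ls : seq 'I_n, well_defined S ls /\ S' = mutates S ls.

Definition arrow n (B : 'M[int]_n) : rel 'I_n := [rel i j | 0 < B i j].

Definition acyclic_seed n k (S : preseed n k) : Prop :=
  forall c : seq 'I_n, cycle (arrow (principal (smat S))) c -> c = [::].

Inductive subring_gen (F : fieldType) (X : F -> Prop) : F -> Prop :=
| Subring_gen z : X z -> subring_gen X z
| Subring_one : subring_gen X 1
| Subring_sub y z : subring_gen X y -> subring_gen X z -> subring_gen X (y - z)
| Subring_mul y z : subring_gen X y -> subring_gen X z -> subring_gen X (y * z).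

Definition ZP n k (S : preseed n k) : ratfun (n + k) -> Prop :=
  subring_gen (fun z => exists j : 'I_k,
    z = svar S (rshift n j) \/ z = (svar S (rshift n j))^-1).

Definition cluster_algebra n k (S0 : preseed n k) : ratfun (n + k) -> Prop :=
  subring_gen (fun z => ZP S0 z \/
    exists2 S, mutation_equivalent S0 S & exists i : 'I_n, z = svar S (lshift k i)).

Definition acyclic_cluster_algebra n k (S0 : preseed n k) : Prop :=
  exists2 S, mutation_equivalent S0 S & acyclic_seed S.

Definition ext_mat n k (B : 'M[int]_(n + k, n)) : 'M[int]_(n + k) :=
  block_mx (usubmx B) (- (dsubmx B)^T) (dsubmx B) 0.

Definition seq_compl (t : seq bool) : seq bool := map negb t.

Definition seq_weight (t : seq bool) : nat := (\sum_(b <- t) b)%N.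

Definition seq_dot (t t' : seq bool) : nat :=
  (\sum_(r < minn (size t) (size t')) nth false t r * nth false t' r)%N.

Definition S_all n (a : {ffun 'I_n -> int}) :=
  {dffun forall i : 'I_n, (absz (pos (a i))).-tuple bool}.

Definition S_gcc n k (B : 'M[int]_(n + k, n)) (a : {ffun 'I_n -> int}) :
    {set S_all a} :=
  [set s : S_all a | [forall i, forall j, arrow (principal B) i j ==>
                       (seq_dot (s i) (seq_compl (s j)) == 0%N)]].

(* s_i, with the convention that s_i is empty at a frozen index i. *)
Definition ext_seq n k (a : {ffun 'I_n -> int}) (s : S_all a) (i : 'I_(n + k)) :
    seq bool :=
  match split i with inl i' => s i' | inr _ => [::] end.

Definition xtilde n k (S : preseed n k) (a : {ffun 'I_n -> int}) :
    ratfun (n + k) :=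
  let x := svar S in
  let b := ext_mat (smat S) in
  (\prod_(l < n) x (lshift k l) ^ (- a l)) *
  \sum_(s in S_gcc (smat S) a)
    \prod_(e : 'I_(n + k) * 'I_(n + k) | arrow b e.1 e.2)
      (x e.1 ^ (b e.1 e.2 * (seq_weight (seq_compl (ext_seq s e.2)))%:Z) *
       x e.2 ^ (- b e.2 e.1 * (seq_weight (ext_seq s e.1))%:Z)).

(* For a subring K of F and a K-submodule M of F (both given as predicates),
   the family v, indexed by I, is a K-basis of M. *)
Definition is_basis (F : fieldType) (I : eqType) (K M : F -> Prop) (v : I -> F) :
    Prop :=
  [/\ forall a, M (v a),
      forall (s : seq I) (c : I -> F), uniq s -> (forall a, K (c a)) ->
        \sum_(a <- s) c a * v a = 0 -> forall a, a \in s -> c a = 0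
    & forall z, M z -> exists (s : seq I) (c : I -> F),
        [/\ uniq s, forall a, K (c a) & z = \sum_(a <- s) c a * v a]].

(* Main.v *)
Require Import Defs.
From mathcomp Require Import all_boot all_order all_algebra.
From mathcomp Require Import mpoly.
From mathcomp Require Import zify ring.

Set Implicit Arguments.
Unset Strict Implicit.
Unset Printing Implicit Defensive.

Import Order.TTheory GRing.Theory Num.Theory.
Local Open Scope ring_scope.

(** Write [x_l' = x_l^-1 (up_l + dn_l)] for the variable obtained from the acyclic
    seed [S] by one mutation at [l]; the two exchange monomials are [up_l], over
    the arrows into [l], and [dn_l], over the arrows out of it. The proof has
    three parts.

    Generators. The cluster algebra is generated over [ZP] by the [x_l] and
    [x_l'] ([cluster_algebra_lower_bound]). For a set [T] of directions let [M_T]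
    be the ring of Laurent polynomials in which the variables of [T] are not
    inverted but accompanied by their primes. The intersection of the [M_T] over
    singletons contains the same intersection for a mutated seed
    ([upper_mutate]), so it contains every cluster variable. If [T] is acyclic,
    then [M_T] is the intersection of the [M_l] for [l] in [T]
    ([mixed_intersection]): for an arrow [l -> l'] inside [T] the variables
    [x_l] and [x_l'] generate the unit ideal of [M_T] ([adjacent_comax]), which
    glues the conditions away from [l] and away from [l']; without arrows the
    exchange polynomials are constants for one another, and what is needed is
    that they are coprime ([exch_regular]). The case where [T] has two elements
    feeds [upper_mutate], the case where [T] is everything gives the assertion
    for [S]. Coprimality holds if the extended matrix has independent columns.
    That is arranged by adding one frozen variable per direction; setting the new
    variables to [1] returns to [S] ([cluster_variable_lower]).

    Spanning. The compatibility condition on the sequences compares entries in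
    equal position only, so [xtilde S a] is a monomial in the [x_l] times a
    product of elements attached to subsets of directions ([xtilde_layers]).
    Each of them equals a product of primed variables up to terms of lower degree
    in the primed variables ([layer_leading]). Hence [xtilde S a] has the standard
    monomial of exponent [a] as leading part, and the exchange relations reduce
    every monomial in the [x_l], [x_l'] to leading parts ([pdeg_spanned]).

    Independence. Number the directions along the arrows and give the earlier ones
    much larger weight. The part of [xtilde S a] of lowest weight is nonzero,
    because [xtilde S a] is a sum of Laurent monomials with coefficient one, and
    its exponent in the mutable variables is a triangular function of [a], with
    [- a i] on the diagonal. For a suitable weight the
    lowest degrees of finitely many of these elements are distinct
    ([xtilde_independent]).

    One device serves throughout: the relation [specializes y y' z z'], which says
    that a rational expression has value [z] at [y] and [z'] at [y']. It is
    a partial ring homomorphism when [y] is algebraically independent. It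
    gives the gradings (scaling the variables by powers of [t]), the invariance of
    algebraic independence under mutation, the removal of the added
    frozen variables, and the fact that sums of Laurent monomials do not vanish. *)

(** * Generated subrings, Laurent monomials and specialization *)

Section SubringGen.
Variables (F : fieldType) (X : F -> Prop).
Local Notation R := (subring_gen X).

Lemma subring_gen0 : R 0.
Proof. by rewrite -(subrr 1); apply: Subring_sub; apply: Subring_one. Qed.

Lemma subring_genN z : R z -> R (- z).
Proof. by move=> Rz; rewrite -sub0r; apply: Subring_sub => //; apply: subring_gen0. Qed.

Lemma subring_genD y z : R y -> R z -> R (y + z).
Proof. by move=> Ry Rz; rewrite -(opprK z); apply: Subring_sub => //; apply: subring_genN. Qed.

Lemma subring_gen_sum I (r : seq I) (P : pred I) (f : I -> F) :
  (forall i, P i -> R (f i)) -> R (\sum_(i <- r | P i) f i).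
Proof. by move=> Rf; elim/big_ind: _ => //; [apply: subring_gen0 | apply: subring_genD]. Qed.

Lemma subring_gen_prod I (r : seq I) (P : pred I) (f : I -> F) :
  (forall i, P i -> R (f i)) -> R (\prod_(i <- r | P i) f i).
Proof.
by move=> Rf; elim/big_ind: _ => //; [apply: Subring_one | apply: Subring_mul].
Qed.

Lemma subring_genX z d : R z -> R (z ^+ d).
Proof.
move=> Rz; elim: d => [|d IH]; first exact: Subring_one.
by rewrite exprS; apply: Subring_mul.
Qed.

Lemma subring_genXz z (d : int) : R z -> 0 <= d -> R (z ^ d).
Proof. by case: d => // d Rz _; apply: subring_genX. Qed.

Lemma subring_genXz_unit z (d : int) : R z -> R z^-1 -> R (z ^ d).
Proof.
by case: d => d Rz Rz'; [apply: subring_genX | rewrite NegzE -exprz_inv; apply: subring_genX]. Qed.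

End SubringGen.

Lemma subring_gen_sub (F : fieldType) (X Y : F -> Prop) :
  (forall z, X z -> subring_gen Y z) ->
  forall z, subring_gen X z -> subring_gen Y z.
Proof.
move=> XY z; elim=> {z} [z /XY //||y z _ ? _ ?|y z _ ? _ ?].
- exact: Subring_one.
- exact: Subring_sub.
- exact: Subring_mul.
Qed.

Section LaurentMonomials.
Variables (F : fieldType) (m : nat) (x : 'I_m -> F).

Definition zmono (e : 'I_m -> int) : F := \prod_j x j ^ e j.

Lemma eq_zmono e e' : e =1 e' -> zmono e = zmono e'.
Proof. by move=> ee; apply: eq_bigr => i _; rewrite ee. Qed.

Lemma zmono0 : zmono (fun=> 0) = 1.
Proof. by rewrite /zmono big1 // => i _; rewrite expr0z. Qed.

Hypothesis x0 : forall j, x j != 0.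

Lemma zmonoD e e' : zmono (fun j => e j + e' j) = zmono e * zmono e'.
Proof. by rewrite /zmono -big_split; apply: eq_bigr => j _; rewrite expfzDr. Qed.

Lemma zmonoN e : zmono (fun j => - e j) = (zmono e)^-1.
Proof. by rewrite /zmono -prodfV; apply: eq_bigr => j _; rewrite invr_expz. Qed.

Lemma zmonoXn e d : zmono e ^+ d = zmono (fun j => e j * d%:Z).
Proof.
by rewrite /zmono -prodrXl; apply: eq_bigr => j _; rewrite exprnP exprz_exp.
Qed.

Lemma zmono_neq0 e : zmono e != 0.
Proof. by apply/prodf_neq0 => j _; rewrite expfz_neq0. Qed.

Lemma zmono1 j : zmono (fun i => (i == j)%:Z) = x j.
Proof.
rewrite /zmono (bigD1 j) //= eqxx expr1z big1 ?mulr1 // => i /negbTE->.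
by rewrite expr0z.
Qed.

Lemma zmono_prod I (r : seq I) (P : pred I) (e : I -> 'I_m -> int) :
  zmono (fun j => \sum_(i <- r | P i) e i j) = \prod_(i <- r | P i) zmono (e i).
Proof.
elim: r => [|i r IH].
  by rewrite big_nil -zmono0; apply: eq_zmono => j; rewrite big_nil.
rewrite big_cons -IH; case: ifP => Pi.
  by rewrite -zmonoD; apply: eq_zmono => j; rewrite big_cons Pi.
by apply: eq_zmono => j; rewrite big_cons Pi.
Qed.

End LaurentMonomials.

Section Specialization.
Variables (K K' : fieldType) (m : nat) (y : 'I_m -> K) (y' : 'I_m -> K').

Definition ev (L : fieldType) (u : 'I_m -> L) (p : {mpoly int[m]}) : L :=
  mmap intr u p.

(** Integer coefficients, so that polynomials can be evaluated in every field. *)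
Definition alg_indep := forall p, ev y p = 0 -> p = 0.

(** A rational expression defined at [y] and at [y'] takes the values [z] and [z'].
    A relation avoids having to construct the local ring on which specialization
    is a map. *)
Definition specializes (z : K) (z' : K') : Prop :=
  exists p q : {mpoly int[m]},
    [/\ ev y q != 0, ev y' q != 0, z = ev y p / ev y q & z' = ev y' p / ev y' q].

Local Notation Sp := specializes.

Lemma evM (L : fieldType) (u : 'I_m -> L) p q : ev u (p * q) = ev u p * ev u q.
Proof. exact: rmorphM. Qed.
Lemma evB (L : fieldType) (u : 'I_m -> L) p q : ev u (p - q) = ev u p - ev u q.
Proof. exact: rmorphB. Qed.
Lemma ev1 (L : fieldType) (u : 'I_m -> L) : ev u 1 = 1.
Proof. exact: rmorph1. Qed.
Lemma ev_var (L : fieldType) (u : 'I_m -> L) i : ev u 'X_i = u i.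
Proof. by rewrite /ev mmapX mmap1U. Qed.

Lemma specializes1 : Sp 1 1.
Proof. by exists 1, 1; rewrite !ev1 !divr1; split=> //; apply: oner_neq0. Qed.

Lemma specializes_var i : Sp (y i) (y' i).
Proof. by exists 'X_i, 1; rewrite !ev1 !ev_var !divr1; split=> //; apply: oner_neq0. Qed.

Lemma specializesM a a' b b' : Sp a a' -> Sp b b' -> Sp (a * b) (a' * b').
Proof.
case=> p [q [q0 q0' -> ->]] [r [s [s0 s0' -> ->]]].
exists (p * r), (q * s); rewrite !evM !mulf_neq0 //; split=> //.
  by rewrite invfM mulrACA.
by rewrite invfM mulrACA.
Qed.

Lemma specializesB a a' b b' : Sp a a' -> Sp b b' -> Sp (a - b) (a' - b').
Proof.
case=> p [q [q0 q0' -> ->]] [r [s [s0 s0' -> ->]]].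
exists (p * s - r * q), (q * s); rewrite !evB !evM !mulf_neq0 //.
by split => //; field; apply/andP.
Qed.

Lemma specializes0 : Sp 0 0.
Proof. by rewrite -(subrr 1) -[X in Sp _ X](subrr 1);
  apply: specializesB; apply: specializes1.
Qed.

Lemma specializesD a a' b b' : Sp a a' -> Sp b b' -> Sp (a + b) (a' + b').
Proof.
move=> Aa Bb; rewrite -(opprK b) -(opprK b') -(sub0r b) -(sub0r b').
by apply: specializesB => //; apply: specializesB => //; apply: specializes0.
Qed.

Lemma specializes_sum I (r : seq I) (P : pred I) (f : I -> K) (f' : I -> K') :
  (forall i, P i -> Sp (f i) (f' i)) ->
  Sp (\sum_(i <- r | P i) f i) (\sum_(i <- r | P i) f' i).
Proof.
by move=> Sf; elim/big_ind2: _ => // *; [apply: specializes0 | apply: specializesD].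
Qed.

Lemma specializes_prod I (r : seq I) (P : pred I) (f : I -> K) (f' : I -> K') :
  (forall i, P i -> Sp (f i) (f' i)) ->
  Sp (\prod_(i <- r | P i) f i) (\prod_(i <- r | P i) f' i).
Proof.
by move=> Sf; elim/big_ind2: _ => // *; [apply: specializes1 | apply: specializesM].
Qed.

Lemma specializesXn a a' d : Sp a a' -> Sp (a ^+ d) (a' ^+ d).
Proof.
by move=> Aa; elim: d => [|d IH]; [apply: specializes1 | rewrite !exprS; apply: specializesM].
Qed.

Hypothesis indep_y : alg_indep.

Lemma specializes_functional a b b' : Sp a b -> Sp a b' -> b = b'.
Proof.
case=> p [q [q0 q0' -> ->]] [r [s [s0 s0' E ->]]].
have /indep_y/(congr1 (ev y')) : ev y (p * s - r * q) = 0.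
  rewrite evB !evM -[ev y p](divfK q0) E mulrAC divfK // subrr //.
rewrite evB !evM /ev mmap0 => /eqP; rewrite subr_eq0 => /eqP Epq.
apply: (mulIf q0'); apply: (mulIf s0').
by rewrite divfK // -/(ev y' _) Epq mulrAC divfK.
Qed.

Lemma specializes0_eq0 b : Sp 0 b -> b = 0.
Proof. by move=> S0b; apply: specializes_functional S0b specializes0. Qed.

Lemma specializesV a a' : Sp a a' -> a' != 0 -> Sp a^-1 a'^-1.
Proof.
move=> [p [q [q0 q0' -> ->]]] a'0; exists q, p; split=> //; rewrite ?invf_div //.
  apply: contra a'0 => /eqP/indep_y->; by rewrite /ev mmap0 mul0r.
by apply: contra a'0 => /eqP->; rewrite mul0r.
Qed.

Lemma specializesXz a a' (d : int) : Sp a a' -> a' != 0 -> Sp (a ^ d) (a' ^ d).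
Proof.
case: d => d Saa a'0; first exact: specializesXn.
by rewrite !NegzE -!exprz_inv; apply: specializesXn; apply: specializesV.
Qed.

Lemma specializes_zmono (u : 'I_m -> K) (u' : 'I_m -> K') e :
  (forall i, Sp (u i) (u' i)) -> (forall i, u' i != 0) ->
  Sp (zmono u e) (zmono u' e).
Proof. by move=> Su u0; apply: specializes_prod => i _; apply: specializesXz. Qed.

Lemma alg_indep_neq0 i : y i != 0.
Proof.
apply/eqP=> yi0; have /indep_y E : ev y 'X_i = 0 by rewrite ev_var.
have /eqP := congr1 (fun p : {mpoly int[m]} => p@_U_(i)%MM) E.
by rewrite mcoeffX mcoeff0 eqxx.
Qed.

End Specialization.

(** * Gradings by weights of the variables *)
Section Decomposition.
Variable F : fieldType.

(** The pieces of a decomposition are the coefficients of a polynomial, shifted by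
    [N] to allow negative degrees, so that the decomposition of a product is the
    product of the polynomials. *)
Definition decomposes (G : int -> F -> Prop) (f : F) : Prop :=
  exists (N : nat) (q : {poly F}),
    f = q.[1] /\ forall i : nat, G (i%:Z - N%:Z) q`_i.

Record graded_family (G : int -> F -> Prop) : Prop := GradedFamily {
  gf1 : G 0 1;
  gfB : forall d y z, G d y -> G d z -> G d (y - z);
  gfM : forall d e y z, G d y -> G e z -> G (d + e) (y * z);
  gf0 : forall d, G d 0
}.

Variable G : int -> F -> Prop.
Hypothesis gG : graded_family G.

Lemma gfD d y z : G d y -> G d z -> G d (y + z).
Proof.
move=> Gy Gz; rewrite -(opprK z); apply: (gfB gG) => //.
by rewrite -sub0r; apply: (gfB gG) => //; apply: (gf0 gG).
Qed.

Lemma gf_sum d I (r : seq I) (P : pred I) (f : I -> F) :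
  (forall i, P i -> G d (f i)) -> G d (\sum_(i <- r | P i) f i).
Proof. by move=> Gf; elim/big_ind: _ => // *; [apply: (gf0 gG) | apply: gfD]. Qed.

Lemma decomposes_hom d z : G d z -> decomposes G z.
Proof.
move=> Gz; case: (intP d) Gz => [|e|e] Gz.
- exists 0, z%:P; rewrite hornerC; split=> // i; rewrite coefC.
  by case: eqP => [->|_]; [rewrite subr0 | apply: (gf0 gG)].
- exists 0, (z *: 'X^(e.+1)); rewrite hornerZ hornerXn expr1n mulr1; split=> // i.
  rewrite coefZ coefXn; case: eqP => [->|_]; first by rewrite mulr1 subr0.
  by rewrite mulr0; apply: (gf0 gG).
- exists e.+1, z%:P; rewrite hornerC; split=> // i; rewrite coefC.
  by case: eqP => [->|_]; [rewrite sub0r | apply: (gf0 gG)].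
Qed.

Lemma decomposesB y z : decomposes G y -> decomposes G z -> decomposes G (y - z).
Proof.
case=> N [p [-> Gp]] [M [q [-> Gq]]].
exists (N + M)%N, (p * 'X^M - q * 'X^N); split.
  by rewrite hornerD hornerN !hornerM !hornerXn !expr1n !mulr1.
move=> i; rewrite coefB !coefMXn; apply: (gfB gG); case: ltnP => h;
  do ?exact: (gf0 gG).
- by have := Gp (i - M)%N; congr G; lia.
- by have := Gq (i - N)%N; congr G; lia.
Qed.

Lemma decomposesM y z : decomposes G y -> decomposes G z -> decomposes G (y * z).
Proof.
case=> N [p [-> Gp]] [M [q [-> Gq]]].
exists (N + M)%N, (p * q); split; first by rewrite hornerM.
move=> i; rewrite coefM; apply: gf_sum => j _.
have /= := gfM gG (Gp j) (Gq (i - j)%N); congr G; have := ltn_ord j; lia.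
Qed.

Lemma subring_gen_decomposes (X : F -> Prop) :
  (forall z, X z -> exists d, G d z) ->
  forall z, subring_gen X z -> decomposes G z.
Proof.
move=> XG z; elim=> {z} [z /XG[d Gz]||y z _ ? _ ?|y z _ ? _ ?].
- exact: decomposes_hom Gz.
- exact: decomposes_hom (gf1 gG).
- exact: decomposesB.
- exact: decomposesM.
Qed.

End Decomposition.

Section Grading.
Variables (F : fieldType) (m : nat) (x : 'I_m -> F).
Hypothesis indep_x : alg_indep x.
Variable w : 'I_m -> int.

Local Notation Ft := {fraction {poly F}}.
Local Notation t := (FracField.tofrac 'X : Ft).
Local Notation "c %:Ft" := (FracField.tofrac (polyC c) : Ft) (at level 1).

Definition twist (i : 'I_m) : Ft := (x i)%:Ft * t ^ w i.

(** The torus element that multiplies [x_i] by [t^(w_i)] multiplies [z] by [t^d]. *)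
Definition homogeneous (d : int) (z : F) : Prop := specializes x twist z (t ^ d * z%:Ft).

Lemma t_neq0 : t != 0.
Proof. by rewrite tofrac_eq0 polyX_eq0. Qed.

Lemma hom_graded : graded_family homogeneous.
Proof.
split.
- by rewrite /homogeneous expr0z mul1r polyC1 tofrac1; apply: specializes1.
- move=> d y z hy hz; rewrite /homogeneous polyCB tofracB mulrBr.
  exact: specializesB.
- move=> d e y z hy hz; rewrite /homogeneous polyCM tofracM.
  by rewrite expfzDr ?t_neq0 // mulrACA; apply: specializesM.
- by move=> d; rewrite /homogeneous polyC0 tofrac0 mulr0; apply: specializes0.
Qed.

Lemma hom_var i : homogeneous (w i) (x i).
Proof. by rewrite /homogeneous mulrC; apply: specializes_var. Qed.

Lemma tofracC_inv z : (z^-1)%:Ft = (z%:Ft)^-1.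
Proof.
have [->|z0] := eqVneq z 0; first by rewrite invr0 polyC0 tofrac0 invr0.
have zF : z%:Ft != 0 by rewrite tofrac_eq0 polyC_eq0.
apply: (mulfI zF).
by rewrite mulfV // -tofracM -polyCM mulfV // polyC1 tofrac1.
Qed.

Lemma homV d z : homogeneous d z -> homogeneous (- d) z^-1.
Proof.
have [->|z0] := eqVneq z 0; first by move=> _; rewrite invr0; apply: (gf0 hom_graded).
move=> hz; rewrite /homogeneous tofracC_inv -invr_expz -invfM; apply: specializesV => //.
apply: mulf_neq0; first exact: expfz_neq0 t_neq0.
by rewrite tofrac_eq0 polyC_eq0.
Qed.

Lemma homXn d z e : homogeneous d z -> homogeneous (d * e%:Z) (z ^+ e).
Proof.
move=> hz; elim: e => [|e IH]; first by rewrite mulr0; apply: (gf1 hom_graded).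
rewrite exprS (_ : d * _ = d + d * e%:Z); last lia.
exact: (gfM hom_graded).
Qed.

Lemma homXz d z e : homogeneous d z -> homogeneous (d * e) (z ^ e).
Proof.
move=> hz; case: e => e; first exact: homXn.
rewrite NegzE -exprz_inv mulrN -mulNr; apply: homXn; exact: homV.
Qed.

Lemma hom_zmono e : homogeneous (\sum_i w i * e i) (zmono x e).
Proof.
rewrite /zmono; elim/big_ind2: _ => [|d a d' a' h h'|i _].
- exact: (gf1 hom_graded).
- exact: (gfM hom_graded).
- exact: homXz (hom_var i).
Qed.

(** Twisting turns a sum of homogeneous pieces into the polynomial in [t] with
    these pieces as coefficients, and twisting sends [0] to [0]. *)
Lemma hom_unique (q : {poly F}) (d : int) :
  (forall i : nat, homogeneous (d + i%:Z) q`_i) -> q.[1] = 0 -> q = 0.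
Proof.
move=> hq q1.
have : specializes x twist q.[1] (t ^ d * FracField.tofrac q).
  have -> : FracField.tofrac q = \sum_(i < size q) t ^+ i * (q`_i)%:Ft.
    rewrite -[q in LHS]coefK poly_def raddf_sum; apply: eq_bigr => i _ /=.
    by rewrite -mul_polyC tofracM tofracXn mulrC.
  rewrite horner_coef mulr_sumr; apply: specializes_sum => i _.
  rewrite expr1n mulr1 mulrA; have := hq i.
  by rewrite /homogeneous expfzDr ?t_neq0 // -exprnP.
rewrite q1; move/(specializes0_eq0 indep_x)/eqP.
rewrite mulf_eq0 (negbTE (expfz_neq0 _ t_neq0)) /=.
by rewrite tofrac_eq0 => /eqP.
Qed.

(** By uniqueness of homogeneous pieces, one decomposition into a smaller family
    [G] forces the pieces of every homogeneous decomposition into [G]. *)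
Lemma hom_coef (G : int -> F -> Prop) (q : {poly F}) (N : nat) :
  graded_family G -> (forall d z, G d z -> homogeneous d z) ->
  (forall i : nat, homogeneous (i%:Z - N%:Z) q`_i) -> decomposes G q.[1] ->
  forall i : nat, G (i%:Z - N%:Z) q`_i.
Proof.
move=> gG Gh hq [M [p [Epq Gp]]] i.
suff E : q * 'X^M - p * 'X^N = 0.
  have := congr1 (fun r : {poly F} => r`_(i + M)) E.
  rewrite coefB coef0 !coefMXn ltnNge leq_addl /= addnK => /eqP.
  rewrite subr_eq0 => /eqP->; case: ltnP => h; first exact: (gf0 gG).
  by have := Gp (i + M - N)%N; congr G; lia.
apply: (@hom_unique _ (- (N + M)%:Z)).
  move=> j; rewrite coefB !coefMXn.
  apply: (gfB hom_graded); case: ltnP => h; do ?exact: (gf0 hom_graded).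
  - by have := hq (j - M)%N; congr homogeneous; lia.
  - by have := Gh _ _ (Gp (j - N)%N); congr homogeneous; lia.
by rewrite hornerD hornerN !hornerM !hornerXn !expr1n !mulr1 Epq subrr.
Qed.

End Grading.

(** * Exchange polynomials and mutation of seeds *)
Lemma specializes_int (K K' : fieldType) m (y : 'I_m -> K) (y' : 'I_m -> K') (z : int) :
  specializes y y' z%:~R z%:~R.
Proof.
exists z%:MP, 1; rewrite !ev1 /ev !mmapC !divr1; split=> //; exact: oner_neq0.
Qed.

Lemma specializes_ev (K K' : fieldType) m (y : 'I_m -> K) (y' : 'I_m -> K') 
  (u : 'I_m -> K) (u' : 'I_m -> K') p :
  (forall i, specializes y y' (u i) (u' i)) ->
  specializes y y' (ev u p) (ev u' p).
Proof.
move=> Su; apply: specializes_sum => e _; apply: specializesM; first exact: specializes_int.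
by apply: specializes_prod => i _; apply: specializesXn.
Qed.

Lemma eq_zmono_off (F : fieldType) m (x x' : 'I_m -> F) e :
  (forall i, x i = x' i \/ e i = 0) -> zmono x e = zmono x' e.
Proof.
move=> h; apply: eq_bigr => i _.
by case: (h i) => [->|->] //; rewrite !expr0z.
Qed.

Lemma zmono_one (F : fieldType) m e : zmono (fun _ : 'I_m => 1 : F) e = 1.
Proof. by rewrite /zmono big1 // => i _; rewrite exp1rz. Qed.

(** Setting every variable to [1] counts the terms. *)
Lemma sum_zmono_neq0 (F : fieldType) m (x : 'I_m -> F) (I : finType) (P : pred I)
    (e : I -> 'I_m -> int) :
  alg_indep x -> (exists i, P i) -> \sum_(i | P i) zmono x (e i) != 0.
Proof.
move=> hx [i0 Pi0]; apply/eqP => E.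
have : specializes x (fun=> 1 : rat) 0 (\sum_(i | P i) 1).
  rewrite -{1}E; apply: specializes_sum => i _.
  rewrite -[X in specializes _ _ _ X](zmono_one rat (e i)).
  apply: (specializes_zmono hx) => j; last exact: oner_neq0.
  exact: (specializes_var x (fun=> 1)).
move/(specializes0_eq0 hx)/eqP; rewrite sumr_const pnatr_eq0 => /eqP/card0_eq/(_ i0).
by rewrite unfold_in Pi0.
Qed.

Lemma pos_ge0 z : 0 <= pos z. Proof. by rewrite /pos; lia. Qed.
Lemma posE z : pos z - pos (- z) = z. Proof. by rewrite /pos; lia. Qed.
Lemma pos_eq0 z : z <= 0 -> pos z = 0. Proof. by rewrite /pos; lia. Qed.
Lemma pos_id z : 0 <= z -> pos z = z. Proof. by rewrite /pos; lia. Qed.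

Section Seeds.
Variables (n k : nat).
Implicit Types (S : preseed n k) (l : 'I_n).

Definition exch_up S l := zmono (svar S) (fun j => pos (smat S j l)).
Definition exch_dn S l := zmono (svar S) (fun j => pos (- smat S j l)).
Definition exch S l := exch_up S l + exch_dn S l.
Definition prime_var S l := svar (mutate S l) (lshift k l).
Definition sign_skew S := sign_skew_symmetric (principal (smat S)).

Lemma prime_varE S l : prime_var S l = (svar S (lshift k l))^-1 * exch S l.
Proof. by rewrite /prime_var ffunE eqxx. Qed.

Lemma mutate_var S l i : i != lshift k l -> svar (mutate S l) i = svar S i.
Proof. by rewrite ffunE => /negbTE->. Qed.

Lemma mutate_frozen S l j : svar (mutate S l) (rshift n j) = svar S (rshift n j).
Proof. by rewrite mutate_var // eq_sym eq_lrshift. Qed.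

Lemma mutate_mat S l i j :
  smat (mutate S l) i j = if (i == lshift k l) || (j == l) then - smat S i j
    else smat S i j + (pos (smat S i l) * pos (smat S (lshift k l) j) -
                       pos (- smat S i l) * pos (- smat S (lshift k l) j)).
Proof.
rewrite mxE; case: ifP => // _; congr (_ + _).
set a := smat S i l; set c := smat S _ j.
rewrite -[RHS](@mulzK _ 2) //; congr (_ %/ _)%Z.
rewrite /pos; have [ha|ha] := lerP 0 a; have [hc|hc] := lerP 0 c;
  rewrite ?[Num.max _ _]maxEle; do ! case: ifP => ?; nia.
Qed.

Lemma sign_skew_diag S l : sign_skew S -> smat S (lshift k l) l = 0.
Proof. by move/(_ l l); rewrite !mxE; case=> [[]|[]|[]] //; lia. Qed.

Lemma sign_skew_pair S i j : sign_skew S ->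
  let a := smat S (lshift k i) j in let b := smat S (lshift k j) i in
  [\/ a = 0 /\ b = 0, 0 < a /\ b < 0 | a < 0 /\ 0 < b].
Proof. by move/(_ i j); rewrite !mxE. Qed.

Lemma arrowE S i j : arrow (principal (smat S)) i j = (0 < smat S (lshift k i) j).
Proof. by rewrite /arrow /= mxE. Qed.

Lemma exch_neq0 S l : alg_indep (svar S) -> exch S l != 0.
Proof.
move=> hx; have := @sum_zmono_neq0 _ _ _ _ predT
  (fun b : bool => if b then fun j => pos (smat S j l) else fun j => pos (- smat S j l)) hx.
by rewrite big_bool; apply; exists true.
Qed.


Lemma exch_mutate S l : sign_skew S -> exch (mutate S l) l = exch S l.
Proof.
move=> sS; rewrite /exch addrC; congr (_ + _); rewrite /exch_up /exch_dn.
  rewrite -(@eq_zmono_off _ _ (svar S)) => [|i].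
    by apply: eq_zmono => j; rewrite mutate_mat eqxx orbT opprK.
  have [->|h] := eqVneq i (lshift k l); last by left; rewrite mutate_var.
  by right; rewrite mutate_mat eqxx sign_skew_diag.
rewrite -(@eq_zmono_off _ _ (svar S)) => [|i].
  by apply: eq_zmono => j; rewrite mutate_mat eqxx orbT.
have [->|h] := eqVneq i (lshift k l); last by left; rewrite mutate_var.
by right; rewrite mutate_mat eqxx sign_skew_diag.
Qed.

Lemma prime_neq0 S l : alg_indep (svar S) -> prime_var S l != 0.
Proof.
move=> hx; rewrite prime_varE mulf_neq0 ?exch_neq0 // invr_eq0.
exact: alg_indep_neq0.
Qed.

Lemma prime_var_mutate S l : sign_skew S -> alg_indep (svar S) ->
  prime_var (mutate S l) l = svar S (lshift k l).
Proof.
move=> sS hx; rewrite prime_varE exch_mutate // -/(prime_var S l) prime_varE.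
by rewrite invfM invrK mulfVK // exch_neq0.
Qed.

Lemma mutateK S l : sign_skew S -> alg_indep (svar S) -> mutate (mutate S l) l = S.
Proof.
move=> sS hx; case: S sS hx => y B sS hx; congr Preseed.
  apply/ffunP => i; have [->|h] := eqVneq i (lshift k l).
    exact: (@prime_var_mutate (Preseed y B) l sS hx).
  by rewrite -[LHS]/(svar (mutate _ _) i) !mutate_var.
apply/matrixP => i j; rewrite -[LHS]/(smat (mutate (mutate (Preseed y B) l) l) i j).
rewrite !mutate_mat /= !eqxx !orbT /=; case: ((i == lshift k l) || (j == l)).
  by rewrite opprK.
by rewrite !opprK; ring.
Qed.

(** Specialising the cluster to its mutation is an involution, so a relation
    satisfied by the mutated cluster specialises to one of the cluster. *)
Lemma mutate_indep S l : sign_skew S -> alg_indep (svar S) -> alg_indep (svar (mutate S l)).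
Proof.
move=> sS hx p p0; apply: (hx p).
suff Sp i : specializes (svar S) (svar (mutate S l)) (svar (mutate S l) i) (svar S i).
  have Sev : specializes (svar S) (svar (mutate S l)) (ev (svar (mutate S l)) p)
    (ev (svar S) p) by apply: specializes_ev.
  by rewrite p0 in Sev; apply: (specializes0_eq0 hx Sev).
have Sx := @specializes_var _ _ _ (svar S) (svar (mutate S l)).
have [->|h] := eqVneq i (lshift k l); last by have := Sx i; rewrite mutate_var.
have -> : svar S (lshift k l) = (prime_var S l)^-1 * exch S l.
  by rewrite prime_varE invfM invrK mulfVK // exch_neq0.
rewrite -/(prime_var S l) {1}prime_varE; apply: specializesM.
  by apply: (specializesV hx); [exact: Sx | exact: prime_neq0].
have mon e : e (lshift k l) = 0 -> specializes (svar S) (svar (mutate S l))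
    (zmono (svar S) e) (zmono (svar S) e).
  move=> e0; rewrite [X in specializes _ _ _ X](@eq_zmono_off _ _ _ (svar (mutate S l))).
    apply: (specializes_zmono hx) => // j; have [->|hj] := eqVneq j (lshift k l).
      exact: prime_neq0.
    by rewrite mutate_var //; apply: alg_indep_neq0.
  move=> j; have [->|hj] := eqVneq j (lshift k l); first by right.
  by left; rewrite mutate_var.
by apply: specializesD; apply: mon; rewrite sign_skew_diag.
Qed.

(** The condition that makes exchange polynomials coprime. *)
Definition full_rank S := forall c : 'I_n -> int,
  (forall i, \sum_j smat S i j * c j = 0) -> forall j, c j = 0.

(** A relation [c] between the new columns is a relation between the old ones after
    changing the coefficient of column [l]. *)
Lemma mutate_full_rank S l : sign_skew S -> full_rank S -> full_rank (mutate S l).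
Proof.
move=> sS fr c hc.
pose b := smat S; pose g := \sum_(j | j != l) pos (b (lshift k l) j) * c j.
have bll : b (lshift k l) l = 0 by exact: sign_skew_diag.
have rowl : \sum_(j | j != l) b (lshift k l) j * c j = 0.
  have := hc (lshift k l); rewrite (bigD1 l) //= mutate_mat eqxx /= -/b bll.
  rewrite oppr0 mul0r add0r => E; apply/eqP; rewrite -oppr_eq0 -sumrN; apply/eqP.
  by rewrite -[RHS]E; apply: eq_bigr => j _; rewrite mutate_mat eqxx /= mulNr.
have gN : \sum_(j | j != l) pos (- b (lshift k l) j) * c j = g.
  apply/eqP; rewrite eq_sym -subr_eq0 /g -sumrB; apply/eqP; rewrite -[RHS]rowl.
  by apply: eq_bigr => j _; rewrite -mulrBl posE.
(* [g] is the common value of the sums of the positive and of the negative parts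
   of row [l] against [c]. *)
pose c' j := if j == l then g - c l else c j.
have c'0 : forall j, c' j = 0.
  apply: fr => i; rewrite (bigD1 l) //= /c' eqxx.
  rewrite (eq_bigr (fun j => b i j * c j)); last by move=> j /negbTE->.
  have [->|hi] := eqVneq i (lshift k l); first by rewrite rowl -/b bll mul0r addr0.
  have := hc i; rewrite (bigD1 l) //= mutate_mat eqxx orbT.
  rewrite (eq_bigr (fun j => b i j * c j + (pos (b i l) * (pos (b (lshift k l) j) * c j) -
     pos (- b i l) * (pos (- b (lshift k l) j) * c j)))); last first.
    by move=> j hj; rewrite mutate_mat (negbTE hi) (negbTE hj) /= -/b; ring.
  rewrite big_split sumrB /= -!mulr_sumr gN -/g -mulrBl posE -/b => E.
  by rewrite -[RHS]E; ring.
have cl j : j != l -> c j = 0 by move=> hj; have := c'0 j; rewrite /c' (negbTE hj).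
move=> j; have [->|hj] := eqVneq j l; last exact: cl.
have := c'0 l; rewrite /c' eqxx /g big1 => [|i hi]; last by rewrite cl ?mulr0.
lia.
Qed.

End Seeds.

(** * Partially inverted algebras and comaximality of adjacent variables *)
Section Mixed.
Variables (n k : nat).
Implicit Types (S : preseed n k) (l : 'I_n) (T : {set 'I_n}).

(** The Laurent polynomials in which the variables of [T] are not inverted but
    accompanied by their primes. Taking all directions for [T] gives the lower
    bound of the seed, and the singletons cut out its upper bound. *)
Definition mixed_gen S T (z : ratfun (n + k)) : Prop :=
  [\/ exists i, z = svar S i,
      exists2 i, (forall l, l \in T -> i != lshift k l) & z = (svar S i)^-1
    | exists2 l, l \in T & z = prime_var S l].

Definition mixed S T := subring_gen (mixed_gen S T).

Lemma mixed_var S T i : mixed S T (svar S i).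
Proof. by apply: Subring_gen; apply: Or31; exists i. Qed.

Lemma mixed_inv S T i :
  (forall l, l \in T -> i != lshift k l) -> mixed S T (svar S i)^-1.
Proof. by move=> h; apply: Subring_gen; apply: Or32; exists i. Qed.

Lemma mixed_zmono S T e :
  (forall l, l \in T -> 0 <= e (lshift k l)) -> mixed S T (zmono (svar S) e).
Proof.
move=> h; apply: subring_gen_prod => i _.
have [/existsP[l /andP[lT /eqP->]]|] := boolP [exists l, (l \in T) && (i == lshift k l)].
  by apply: subring_genXz; [exact: mixed_var | exact: h].
move/existsPn => hi; apply: subring_genXz_unit; [exact: mixed_var | apply: mixed_inv => l lT].
by have := hi l; rewrite lT.
Qed.

Lemma mixed_up S T l : mixed S T (exch_up S l).
Proof. by apply: mixed_zmono => i _; apply: pos_ge0. Qed.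

Lemma mixed_dn S T l : mixed S T (exch_dn S l).
Proof. by apply: mixed_zmono => i _; apply: pos_ge0. Qed.

Lemma mixed_exch S T l : mixed S T (exch S l).
Proof. by apply: subring_genD; [apply: mixed_up | apply: mixed_dn]. Qed.

Lemma mixed_prime S T l : mixed S T (prime_var S l).
Proof.
have [lT|lT] := boolP (l \in T); first by apply: Subring_gen; apply: Or33; exists l.
rewrite prime_varE; apply: Subring_mul; last exact: mixed_exch.
apply: mixed_inv => i iT; rewrite (inj_eq (@lshift_inj _ _)).
by apply: contra lT => /eqP->.
Qed.

Lemma mixedS S T T' z : T \subset T' -> mixed S T' z -> mixed S T z.
Proof.
move=> /subsetP sTT; apply: subring_gen_sub => {}z [[i ->]|[i h ->]|[l _ ->]].
- exact: mixed_var.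
- by apply: mixed_inv => l /sTT; apply: h.
- exact: mixed_prime.
Qed.

Lemma mixed_clear S T l z : svar S (lshift k l) != 0 ->
  mixed S (T :\ l) z -> exists d, mixed S T (svar S (lshift k l) ^+ d * z).
Proof.
set x := svar S _ => x0; elim=> {z} [z||y z _ [d Hy] _ [e Hz]|y z _ [d Hy] _ [e Hz]].
- case=> [[i ->]|[i h ->]|[i iT ->]].
  + by exists 0; rewrite mul1r; apply: mixed_var.
  + have [->|il] := eqVneq i (lshift k l).
      by exists 1; rewrite expr1 mulfV //; apply: Subring_one.
    exists 0; rewrite mul1r; apply: mixed_inv => l' l'T.
    have [->|l'l] := eqVneq l' l; first by [].
    by apply: h; rewrite !inE l'l.
  + by exists 0; rewrite mul1r; apply: mixed_prime.
- by exists 0; rewrite mul1r; apply: Subring_one.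
- exists (d + e)%N; rewrite exprD mulrBr {1}[_ ^+ d * _]mulrC -!mulrA.
  have Mx := mixed_var S T (lshift k l).
  by apply: Subring_sub; apply: Subring_mul => //; apply: subring_genX.
- by exists (d + e)%N; rewrite exprD mulrACA; apply: Subring_mul.
Qed.

Definition comax S T (a b : ratfun (n + k)) : Prop :=
  exists c d, [/\ mixed S T c, mixed S T d & c * a + d * b = 1].

Lemma comaxC S T a b : comax S T a b -> comax S T b a.
Proof. by case=> c [d [Mc Md E]]; exists d, c; rewrite addrC. Qed.

Lemma comaxM S T a b b' : mixed S T a -> mixed S T b ->
  comax S T a b -> comax S T a b' -> comax S T a (b * b').
Proof.
move=> Ma Mb [c [d [Mc Md E]]] [c' [d' [Mc' Md' E']]].
exists (c + d * b * c'), (d * d'); split.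
- by apply: subring_genD => //; do ![apply: Subring_mul => //].
- exact: Subring_mul.
- by rewrite -E -[d * b in RHS]mulr1 -E'; ring.
Qed.

Lemma comax1 S T a : comax S T a 1.
Proof.
exists 0, 1; split; rewrite ?mul0r ?mulr1 ?add0r //; first exact: subring_gen0.
exact: Subring_one.
Qed.

Lemma comax_unit S T a b : b != 0 -> mixed S T b^-1 -> comax S T a b.
Proof.
move=> b0 Mb; exists 0, b^-1; split=> //; first exact: subring_gen0.
by rewrite mul0r add0r mulVf.
Qed.

Lemma comaxX S T a b d : mixed S T a -> mixed S T b ->
  comax S T a b -> comax S T a (b ^+ d).
Proof.
move=> Ma Mb C; elim: d => [|d IH]; first exact: comax1.
by rewrite exprS; apply: comaxM.
Qed.

Lemma comax_mem S T a b z :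
  comax S T a b -> mixed S T (a * z) -> mixed S T (b * z) -> mixed S T z.
Proof.
case=> c [d [Mc Md E]] Ma Mb; rewrite -[z]mul1r -E mulrDl -!mulrA.
by apply: subring_genD; apply: Subring_mul.
Qed.

(** Acyclicity in the form in which it is used, for inductions along the arrows. *)
Definition acyclic_on S T := exists rk : 'I_n -> nat,
  forall l l', l \in T -> l' \in T -> 0 < smat S (lshift k l) l' -> (rk l < rk l')%N.

Lemma acyclic_onS S T T' : T \subset T' -> acyclic_on S T' -> acyclic_on S T.
Proof. by move=> /subsetP sTT [rk h]; exists rk => l l' /sTT + /sTT; apply: h. Qed.

(** Adjacent variables of an acyclic part are comaximal: the exchange relation
    of [l'] writes one of its two monomials, a product of later variables,
    inside the ideal generated by [x_l] and [x_l']; by induction along the order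
    each of those later variables is comaximal with [x_l'].  *)
Lemma adjacent_comax S T l l' : alg_indep (svar S) -> sign_skew S -> acyclic_on S T ->
  l \in T -> l' \in T -> 0 < smat S (lshift k l) l' ->
  comax S T (svar S (lshift k l)) (svar S (lshift k l')).
Proof.
move=> hx sS [rk hrk].
have [N] := ubnP (\max_j rk j - rk l')%N; elim: N l l' => // N IH l l' hN lT l'T ll'.
have x0 i : svar S i != 0 := alg_indep_neq0 hx i.
have Mx i := mixed_var S T i.
have [a [d [Ma Md E]]] : comax S T (svar S (lshift k l')) (exch_dn S l').
  suff [] : mixed S T (exch_dn S l') /\ comax S T (svar S (lshift k l')) (exch_dn S l') by [].
  rewrite /exch_dn /zmono; elim/big_ind: _ => [|y z [My Cy] [Mz Cz]|i _].
  - by split; [apply: Subring_one | apply: comax1].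
  - by split; [apply: Subring_mul | apply: comaxM].
  have [/existsP[i' /andP[iT /eqP->]]|] := boolP [exists l, (l \in T) && (i == lshift k l)].
    split; first by apply: subring_genXz; [exact: Mx | apply: pos_ge0].
    have [h|h] := lerP 0 (smat S (lshift k i') l').
      by rewrite pos_eq0 ?expr0z; [apply: comax1 | lia].
    have := pos_ge0 (- smat S (lshift k i') l'); case: (pos _) => // e _.
    apply: comaxX => //; apply: IH => //; last first.
      by have [[]|[]|[]] := sign_skew_pair l' i' sS; lia.
    have l'i' : (rk l' < rk i')%N.
      by apply: hrk => //; have [[]|[]|[]] := sign_skew_pair l' i' sS; lia.
    have := leq_bigmax (F := rk) i'; lia.
  move/existsPn => hi; have Mi : mixed S T (svar S i)^-1.
    by apply: mixed_inv => j jT; have := hi j; rewrite jT.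
  split; first exact: (subring_genXz_unit _ (Mx i) Mi).
  apply: comax_unit; first exact: expfz_neq0.
  by rewrite invr_expz; apply: (subring_genXz_unit _ (Mx i) Mi).
pose U := zmono (svar S) (fun j => pos (smat S j l') - (j == lshift k l)%:Z).
have MU : mixed S T U.
  apply: mixed_zmono => j jT; case: eqP => [->|_]; last by rewrite subr0; apply: pos_ge0.
  by rewrite pos_id; lia.
have EU : exch_up S l' = svar S (lshift k l) * U.
  rewrite -(zmono1 (svar S) (lshift k l)) -zmonoD //; apply: eq_zmono => j.
  by rewrite addrC subrK.
have Edn : exch_dn S l' = svar S (lshift k l') * prime_var S l' - svar S (lshift k l) * U.
  by rewrite prime_varE mulVKf // -EU /exch addrC addKr.
exists (- (d * U)), (a + d * prime_var S l'); split.
- by apply: subring_genN; apply: Subring_mul.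
- by apply: subring_genD => //; apply: Subring_mul => //; apply: mixed_prime.
- by rewrite -E Edn; ring.
Qed.

End Mixed.

(** * Intersections of partially inverted algebras *)
Section Intersection.
Variables (n k : nat) (S : preseed n k).
Hypotheses (indep : alg_indep (svar S)) (sS : sign_skew S).
Local Notation x := (svar S).
Local Notation b := (smat S).
Local Notation M := (mixed S).
Local Notation homx := (homogeneous x).

Let x0 i : x i != 0 := alg_indep_neq0 indep i.

Section Weight.
Variable w : 'I_(n + k) -> int.

Lemma hom_graded_sub T : graded_family (fun d z => M T z /\ homx w d z).
Proof.
have g := hom_graded x w; split.
- by split; [apply: Subring_one | apply: (gf1 g)].
- by move=> d y z [? ?] [? ?]; split; [apply: Subring_sub | apply: (gfB g)].
- by move=> d e y z [? ?] [? ?]; split; [apply: Subring_mul | apply: (gfM g)].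
- by move=> d; split; [apply: subring_gen0 | apply: (gf0 g)].
Qed.

(** The quotient of the two exchange monomials is the Laurent monomial whose
    exponents form the column, here of degree [0]. *)
Lemma hom_exch l : \sum_j w j * b j l = 0 ->
  homx w (\sum_j w j * pos (- b j l)) (exch S l).
Proof.
move=> wl; apply: gfD; [exact: hom_graded | | exact: hom_zmono].
have <- : \sum_j w j * pos (b j l) = \sum_j w j * pos (- b j l).
  apply/eqP; rewrite -subr_eq0 -sumrB; apply/eqP; rewrite -[RHS]wl.
  by apply: eq_bigr => j _; rewrite -mulrBr posE.
exact: hom_zmono.
Qed.

Lemma hom_prime l : \sum_j w j * b j l = 0 ->
  homx w (- w (lshift k l) + \sum_j w j * pos (- b j l)) (prime_var S l).
Proof.
move=> wl; rewrite prime_varE; apply: (gfM (hom_graded x w)).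
  by apply: homV => //; apply: hom_var.
exact: hom_exch.
Qed.

Lemma mixed_decomposes (T : {set 'I_n}) z : (forall l, l \in T -> \sum_j w j * b j l = 0) ->
  M T z -> decomposes (fun d z => M T z /\ homx w d z) z.
Proof.
move=> wT; apply: subring_gen_decomposes; first exact: hom_graded_sub.
move=> {}z [[i ->]|[i h ->]|[l lT ->]].
- by exists (w i); split; [apply: mixed_var | apply: hom_var].
- by exists (- w i); split; [apply: mixed_inv | apply: homV => //; apply: hom_var].
- by eexists; split; [apply: mixed_prime | apply: hom_prime; apply: wT].
Qed.

End Weight.

Hypothesis fr : full_rank S.

(** Two independent columns are separated by a weight: one of their 2 x 2 minors
    is nonzero, and expanding it gives the weight. *)
Lemma separating_weight i j : i != j -> exists w : 'I_(n + k) -> int,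
  \sum_r w r * b r i = 0 /\ 0 < \sum_r w r * b r j.
Proof.
move=> ij.
have [p bpi] : exists p, b p i != 0.
  apply/existsP; apply: contraT => /existsPn h.
  suff : (i == i)%:Z = 0 by rewrite eqxx.
  apply: (fr (c := fun l => (l == i)%:Z)) => r; rewrite big1 // => l _.
  case: eqP => [->|_]; last by rewrite mulr0.
  by rewrite mulr1; apply/eqP; have := h r; rewrite negbK.
have [q bq] : exists q, b p i * b q j - b q i * b p j != 0.
  apply/existsP; apply: contraT => /existsPn h.
  pose c l := if l == i then - b p j else if l == j then b p i else 0.
  have ji : (j == i) = false by rewrite eq_sym (negbTE ij).
  suff /eqP : c j = 0 by rewrite /c ji eqxx (negbTE bpi).
  apply: fr => r; rewrite (bigD1 i) //= (bigD1 j) ?ji //=.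
  rewrite /c eqxx ji eqxx big1 ?addr0 => [|l /andP[/negbTE-> /negbTE->]].
    by have := h r; rewrite negbK => /eqP E; rewrite -[RHS]E; ring.
  by rewrite mulr0.
pose D := b p i * b q j - b q i * b p j.
pose w r := sgz D * (b p i * (r == q)%:Z - b q i * (r == p)%:Z).
have E l : \sum_r w r * b r l = sgz D * (b p i * b q l - b q i * b p l).
  rewrite /w (eq_bigr (fun r => sgz D * (b p i * ((r == q)%:Z * b r l)) -
     sgz D * (b q i * ((r == p)%:Z * b r l)))); last by move=> r _; ring.
  have S1 s : \sum_r (r == s)%:Z * b r l = b s l.
    rewrite (bigD1 s) //= eqxx mul1r big1 ?addr0 // => r /negbTE->.
    by rewrite mul0r.
  by rewrite sumrB -!mulr_sumr !S1; ring.
exists w; rewrite !E; split; first by ring.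
by rewrite -/D; case: sgzP (bq : D != 0); lia.
Qed.

(** Nonadjacent exchange polynomials are coprime when the columns are independent.
    In a grading for which [exch S i] is homogeneous and the two monomials of
    [exch S j] have different degrees, the lowest piece of [exch S j * z] is a
    unit times the lowest piece of [z]. *)
Lemma exch_regular i j z : i != j -> b (lshift k i) j = 0 -> M set0 z ->
  M [set i] (exch S j * z) -> M [set i] z.
Proof.
move=> ij bij Mz MPz; have [w [wi wj]] := separating_weight ij.
have bdn0 : exch_dn S j != 0 by apply: zmono_neq0.
have Mi e : e (lshift k i) = 0 -> M [set i] (zmono x e).
  by move=> e0; apply: mixed_zmono => l /set1P->; rewrite e0.
pose u := exch_up S j / exch_dn S j.
have Eu : u = zmono x (b^~ j).
  rewrite /u /exch_up /exch_dn -zmonoN // -zmonoD //.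
  by apply: eq_zmono => r; rewrite posE.
have Mu : M [set i] u by rewrite Eu; apply: Mi.
have hu : homx w (\sum_r w r * b r j) u by rewrite Eu; apply: hom_zmono.
have {wj} : exists d : nat, \sum_r w r * b r j = d.+1%:Z.
  by exists (absz (\sum_r w r * b r j)).-1; lia.
case=> d Ed; rewrite Ed in hu.
have {MPz} MPz : M [set i] (z * (1 + u)).
  have -> : z * (1 + u) = (exch_dn S j)^-1 * (exch S j * z).
    by rewrite /u /exch [_^-1 * _]mulrC -mulrA [z / _]mulrC mulrA mulrDl divff // mulrC addrC.
  have Mdn : M [set i] (exch_dn S j)^-1.
    by rewrite /exch_dn -zmonoN //; apply: Mi; rewrite bij.
  exact: Subring_mul.
have [] := mixed_decomposes (w := w) _ Mz; first by move=> l; rewrite inE.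
move=> N [q [Ez hq]].
pose r : {poly ratfun (n + k)} := q + u *: (q * 'X^(d.+1)).
have hr a : homx w (a%:Z - N%:Z) r`_a.
  rewrite coefD coefZ coefMXn; apply: gfD; [exact: hom_graded | exact: (hq a).2 |].
  case: ltnP => h; first by rewrite mulr0; apply: (gf0 (hom_graded x w)).
  have := gfM (hom_graded x w) hu (hq (a - d.+1)%N).2; congr homogeneous; lia.
have Mr : forall a, M [set i] r`_a.
  move=> a; suff [] : M [set i] r`_a /\ homx w (a%:Z - N%:Z) r`_a by [].
  apply: (hom_coef indep (G := fun d z => M [set i] z /\ homx w d z) _ _ hr).
  - exact: hom_graded_sub.
  - by move=> ? ? [].
  - apply: mixed_decomposes; first by move=> l /set1P->.
    rewrite hornerD hornerZ hornerM hornerXn expr1n mulr1 -Ez.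
    by have -> : z + u * z = z * (1 + u) by ring.
have Mq : forall a, M [set i] q`_a.
  move=> a; have [A] := ubnP a; elim: A a => // A IH a aA.
  have -> : q`_a = r`_a - (u *: (q * 'X^(d.+1)))`_a by rewrite coefD addrK.
  apply: Subring_sub; first exact: Mr.
  rewrite coefZ coefMXn; case: ltnP => h.
    by rewrite mulr0; apply: subring_gen0.
  by apply: Subring_mul => //; apply: IH; lia.
rewrite Ez horner_coef; apply: subring_gen_sum => a _; rewrite expr1n mulr1; exact: Mq.
Qed.

Lemma delta_sum j (e : 'I_(n + k) -> int) :
  \sum_r (r == j)%:Z * e r = e j.
Proof.
rewrite (bigD1 j) //= eqxx mul1r big1 ?addr0 // => r /negbTE->.
by rewrite mul0r.
Qed.

Section Nonadjacent.
Variables (T : {set 'I_n}) (j : 'I_n).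
Hypothesis jT : j \in T.
Hypothesis discrete : forall l l', l \in T -> l' \in T -> b (lshift k l) l' = 0.
Local Notation T' := (T :\ j).
Local Notation xj := (x (lshift k j)).
Local Notation homj := (homx (fun r => (r == lshift k j)%:Z)).

Let gj := hom_graded x (fun r => (r == lshift k j)%:Z).

Let exch_j l : l \in T -> homj 0 (exch S l).
Proof.
move=> lT; have := @hom_exch (fun r => (r == lshift k j)%:Z) l.
by rewrite !delta_sum discrete // => /(_ erefl); rewrite oppr0 pos_eq0.
Qed.

Let homxj d : homj d (xj ^ d).
Proof.
have := homXz indep d (hom_var x (fun r => (r == lshift k j)%:Z) (lshift k j)).
by rewrite eqxx mul1r.
Qed.

(** In degree [d] for [x_j], an element of the algebra in which [x_j] is inverted is
    [x_j^d] times an element free of [x_j]. If only [x_j] is not inverted, a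
    negative [d] requires in addition a factor [exch S j ^ (- d)]. *)
Let away d z := exists2 h, M T h /\ homj 0 h & z = h * xj ^ d.
Let near d z := exists2 c, M set0 c /\ homj 0 c &
  z = c * exch S j ^+ `|pos (- d)| * xj ^ d.

Let away_graded : graded_family away.
Proof.
split.
- by exists 1; [split; [apply: Subring_one | apply: (gf1 gj)] | rewrite expr0z mul1r].
- move=> d _ _ [h [Mh hh] ->] [h' [Mh' hh'] ->]; exists (h - h'); last by rewrite mulrBl.
  by split; [apply: Subring_sub | apply: (gfB gj)].
- move=> d e _ _ [h [Mh hh] ->] [h' [Mh' hh'] ->]; exists (h * h').
    by split; [apply: Subring_mul | rewrite -[0]addr0; apply: (gfM gj)].
  by rewrite expfzDr // mulrACA.
- by move=> d; exists 0; [split; [apply: subring_gen0 | apply: (gf0 gj)] | rewrite mul0r].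
Qed.

Let near_graded : graded_family near.
Proof.
split.
- exists 1; first by split; [apply: Subring_one | apply: (gf1 gj)].
  by rewrite expr0z !mul1r.
- move=> d _ _ [h [Mh hh] ->] [h' [Mh' hh'] ->]; exists (h - h').
    by split; [apply: Subring_sub | apply: (gfB gj)].
  by rewrite !mulrBl.
- move=> d e _ _ [h [Mh hh] ->] [h' [Mh' hh'] ->].
  have [a Ea] : exists a : nat, (`|pos (- d)| + `|pos (- e)| = a + `|pos (- (d + e))%R|)%N.
    exists (`|pos (- d)| + `|pos (- e)| - `|pos (- (d + e))%R|)%N.
    by rewrite /pos; lia.
  exists (h * h' * exch S j ^+ a).
    split; first by do !apply: Subring_mul => //; apply: subring_genX; apply: mixed_exch.
    rewrite -[0]addr0; apply: (gfM gj); first by rewrite -[0]addr0; apply: (gfM gj).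
    by have := homXn a (exch_j jT); rewrite mul0r.
  by rewrite mulrACA (mulrACA h) -exprD Ea exprD [h * h' * (_ * _)]mulrA expfzDr.
- by move=> d; exists 0; [split; [apply: subring_gen0 | apply: (gf0 gj)] | rewrite !mul0r].
Qed.

Let away_decomposes z : M T' z -> decomposes away z.
Proof.
apply: subring_gen_decomposes; first exact: away_graded.
have var i : exists d, away d (x i).
  have [->|ij] := eqVneq i (lshift k j).
    exists 1, 1; last by rewrite mul1r expr1z.
    by split; [apply: Subring_one | apply: (gf1 gj)].
  exists 0, (x i); last by rewrite expr0z mulr1.
  split; first exact: mixed_var.
  by have := hom_var x (fun r => (r == lshift k j)%:Z) i; rewrite (negbTE ij).
move=> {}z [[i ->]|[i h ->]|[l /setD1P[lj lT] ->]].
- exact: var.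
- have [->|ij] := eqVneq i (lshift k j).
    exists (-1), 1; last by rewrite mul1r exprN1.
    by split; [apply: Subring_one | apply: (gf1 gj)].
  exists 0, (x i)^-1; last by rewrite expr0z mulr1.
  split.
    apply: mixed_inv => l lT; have [->|lj] := eqVneq l j; first by [].
    by apply: h; rewrite !inE lj.
  have := homV indep (hom_var x (fun r => (r == lshift k j)%:Z) i).
  by rewrite (negbTE ij) oppr0.
- exists 0, (prime_var S l); last by rewrite expr0z mulr1.
  split; first exact: mixed_prime.
  have := @hom_prime (fun r => (r == lshift k j)%:Z) l.
  rewrite !delta_sum discrete // => /(_ erefl).
  by rewrite (inj_eq (@lshift_inj _ _)) (negbTE lj).
Qed.

Let near_decomposes z : M [set j] z -> decomposes near z.
Proof.
apply: subring_gen_decomposes; first exact: near_graded.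
move=> {}z [[i ->]|[i h ->]|[l /set1P-> ->]].
- have [->|ij] := eqVneq i (lshift k j).
    exists 1, 1; last by rewrite !mul1r expr1z.
    by split; [apply: Subring_one | apply: (gf1 gj)].
  exists 0, (x i); last by rewrite expr0z !mulr1.
  split; first exact: mixed_var.
  by have := hom_var x (fun r => (r == lshift k j)%:Z) i; rewrite (negbTE ij).
- have ij := h j (set11 j).
  exists 0, (x i)^-1; last by rewrite expr0z !mulr1.
  split; first by apply: mixed_inv => l; rewrite inE.
  have := homV indep (hom_var x (fun r => (r == lshift k j)%:Z) i).
  by rewrite (negbTE ij) oppr0.
- exists (-1), 1; last by rewrite mul1r exprN1 prime_varE expr1 mulrC.
  by split; [apply: Subring_one | apply: (gf1 gj)].
Qed.

(** Comparing pieces of equal degree in [x_j], the coefficient is divisible by a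
    power of [exch S j]. The quotient satisfies the conditions at the other
    elements of [T] because [exch S j] is regular there, so the induction
    hypothesis applies to it. *)
Lemma mixed_step z :
  (forall c, M set0 c -> (forall l, l \in T' -> M [set l] c) -> M T' c) ->
  M T' z -> M [set j] z -> M T z.
Proof.
move=> IH M'z Mjz.
have away_hom d y : away d y -> homj d y.
  by case=> h [_ hh] ->; have := gfM gj hh (homxj d); rewrite add0r.
have away0 c : M T' c -> homj 0 c -> M T c.
  move=> M'c hc; have [] : away (0%:Z - 0%:Z) (c%:P)`_0.
    apply: (hom_coef indep away_graded away_hom) => [i|].
      by rewrite coefC; case: eqP => [->|_]; [rewrite subr0 | apply: (gf0 gj)].
    by rewrite hornerC; apply: away_decomposes.
  by move=> h [Mh _]; rewrite coefC eqxx subr0 expr0z mulr1 => ->.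
have [N [q [Ez hq]]] := near_decomposes Mjz.
have near_hom d y : near d y -> homj d y.
  case=> c [_ hc] ->; have hP := homXn `|pos (- d)| (exch_j jT).
  by have := gfM gj (gfM gj hc hP) (homxj d); rewrite mul0r !add0r.
have aq i : away (i%:Z - N%:Z) q`_i.
  apply: (hom_coef indep away_graded away_hom) => [a|]; first exact: near_hom.
  by rewrite -Ez; apply: away_decomposes.
rewrite Ez horner_coef; apply: subring_gen_sum => i _; rewrite expr1n mulr1.
have [h [Mh hh] Eh] := aq i; have [c [Mc hc] Ec] := hq i.
set d := i%:Z - N%:Z in Eh Ec; set P := exch S j in Ec.
have Eq : h = c * P ^+ `|pos (- d)|.
  by apply: (mulIf (expfz_neq0 d (x0 (lshift k j)))); rewrite -Ec Eh.
have MTc : M T c.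
  apply: (away0) => //; apply: IH => // l /setD1P[lj lT].
  have : M [set l] (P ^+ `|pos (- d)| * c).
    by rewrite mulrC -Eq; apply: mixedS Mh; rewrite sub1set.
  elim: `|pos (- d)|%N => [|e IHe]; first by rewrite mul1r.
  rewrite exprS -mulrA => h'; apply: IHe; apply: exch_regular h' => //.
    exact: discrete.
  by apply: Subring_mul => //; apply: subring_genX; apply: mixed_exch.
rewrite Ec -mulrA; apply: Subring_mul => //.
have [d0|d0] := lerP 0 d.
  rewrite pos_eq0 ?mul1r; last by lia.
  by apply: subring_genXz => //; apply: mixed_var.
have [e Ee] : exists e : nat, d = - e%:Z by exists `|d|%N; lia.
rewrite pos_id; last by lia.
rewrite Ee opprK absz_nat -exprz_inv -exprMn mulrC -prime_varE.
by apply: subring_genX; apply: mixed_prime.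
Qed.

End Nonadjacent.

(** Along an arrow of [T], comaximality of its ends glues the conditions away from
    each of them; without arrows, coprimality does. *)
Theorem mixed_intersection (T : {set 'I_n}) z : acyclic_on S T -> M set0 z ->
  (forall l, l \in T -> M [set l] z) -> M T z.
Proof.
have [N] := ubnP #|T|; elim: N T z => // N IH T z cT aT M0 Mz.
have IH' l c : l \in T -> M set0 c -> (forall l', l' \in T :\ l -> M [set l'] c) ->
    M (T :\ l) c.
  move=> lT M0c Mc; apply: IH => //; last exact: acyclic_onS (subsetDl _ _) aT.
  by move: cT; rewrite (cardsD1 l) lT.
have Mdel l : l \in T -> M (T :\ l) z.
  by move=> lT; apply: IH' => // l' /setD1P[_]; apply: Mz.
have [/existsP[l /existsP[l' /and3P[lT l'T ll']]]|noarrow] :=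
    boolP [exists l, exists l', [&& l \in T, l' \in T & 0 < b (lshift k l) l']].
  have [d Md] := mixed_clear (x0 _) (Mdel l lT).
  have [e Me] := mixed_clear (x0 _) (Mdel l' l'T).
  have C := adjacent_comax indep sS aT lT l'T ll'.
  apply: comax_mem Md Me.
  do 2!(apply: comaxX; [by do ?apply: subring_genX; apply: mixed_var |
    exact: mixed_var | apply: comaxC]).
  exact: C.
have [->|[j jT]] := set_0Vmem T; first by [].
apply: (mixed_step jT) (Mdel j jT) (Mz j jT).
  move=> l l' lT l'T; have h1 := existsPn (existsPn noarrow l) l'.
  have h2 := existsPn (existsPn noarrow l') l.
  rewrite lT l'T /= in h1 h2.
  by have [[]|[]|[]] := sign_skew_pair l l' sS; lia.
by move=> c M0c Mc; apply: IH'.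
Qed.

End Intersection.

(** * Invariance of the upper bound under mutation *)
Section UpperBound.
Variables (n k : nat).
Implicit Types (S : preseed n k) (l j : 'I_n).

(** Changing all signs swaps the two exchange monomials and commutes with mutation,
    which reduces the next computation to one sign. *)
Definition opposite S : preseed n k := Preseed (svar S) (- smat S).

Lemma opposite_exch S l : exch (opposite S) l = exch S l.
Proof.
rewrite /exch addrC; congr (_ + _); apply: eq_zmono => i; rewrite /= mxE //.
by rewrite opprK.
Qed.

Lemma opposite_mutate S l : mutate (opposite S) l = opposite (mutate S l).
Proof.
congr Preseed.
  apply/ffunP => i; rewrite -[LHS]/(svar (mutate (opposite S) l) i).
  rewrite -[RHS]/(svar (mutate S l) i); have [->|h] := eqVneq i (lshift k l).
    by rewrite -!/(prime_var _ l) !prime_varE opposite_exch.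
  by rewrite !mutate_var.
apply/matrixP => i j; rewrite -[LHS]/(smat (mutate (opposite S) l) i j).
rewrite [RHS]mxE -[X in - X]/(smat (mutate S l) i j).
rewrite !mutate_mat /= !mxE; case: ifP => // _; rewrite !opprK; ring.
Qed.

Lemma opposite_prime S l : prime_var (opposite S) l = prime_var S l.
Proof. by rewrite !prime_varE opposite_exch. Qed.

Lemma opposite_mixed S T z : mixed (opposite S) T z -> mixed S T z.
Proof.
apply: subring_gen_sub => {}z [[i ->]|[i h ->]|[l _ ->]].
- exact: mixed_var.
- exact: mixed_inv.
- by rewrite opposite_prime; apply: mixed_prime.
Qed.

Lemma opposite_sign_skew S : sign_skew S -> sign_skew (opposite S).
Proof.
move=> sS i j; rewrite !mxE; have [[-> ->]|[]|[]] := sign_skew_pair i j sS; rewrite ?oppr0.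
- exact: Or31.
- by move=> ? ?; apply: Or33; rewrite oppr_lt0 oppr_gt0.
- by move=> ? ?; apply: Or32; rewrite oppr_lt0 oppr_gt0.
Qed.

(** The rank two computation: [x_j''] obtained by mutating at [l] and then at
    [j] is, up to a unit, [x_l'^c x_j'] minus a correction, where [c] is the
    entry joining [l] to [j]. The correction is divisible by [x_j] before the
    division by [x_j] because [exch S l] is congruent to [exch_up S l] modulo
    [x_j]. *)
Lemma second_prime_pos S l j : alg_indep (svar S) -> sign_skew S ->
  0 < smat S (lshift k l) j ->
  mixed S [set l; j] (prime_var (mutate S l) j).
Proof.
set b := smat S; set x := svar S => hx sS blj.
have x0 i : x i != 0 := alg_indep_neq0 hx i.
have bjl : b (lshift k j) l < 0 by have [[]|[]|[]] := sign_skew_pair l j sS; rewrite -/b; lia.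
have [bll bjj] : b (lshift k l) l = 0 /\ b (lshift k j) j = 0.
  by split; apply: sign_skew_diag.
have jl : j != l by apply: contraTneq bjl => ->; rewrite bll ltxx.
have jl' : lshift k j != lshift k l by rewrite (inj_eq (@lshift_inj _ _)).
have [c Ec] : exists c : nat, b (lshift k l) j = c%:Z by exists `|b (lshift k l) j|%N; lia.
pose b' := smat (mutate S l).
have Eb' i : i != lshift k l -> b' i j = b i j + pos (b i l) * c%:Z.
  move=> il; rewrite /b' mutate_mat (negbTE il) (negbTE jl) /= -/b Ec.
  by rewrite (pos_id (z := c%:Z)) // (pos_eq0 (z := - c%:Z)) ?mulr0 ?subr0; lia.
have Eb'l : b' (lshift k l) j = - c%:Z by rewrite /b' mutate_mat eqxx /= -/b Ec.
pose off (e : 'I_(n + k) -> int) i := if i == lshift k l then 0 else e i.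
pose A0 := zmono x (off (fun i => pos (b i j))).
have EA : exch_up S j = x (lshift k l) ^+ c * A0.
  rewrite exprnP -[x (lshift k l)](zmono1 x) -exprnP zmonoXn -zmonoD //.
  apply: eq_zmono => i; rewrite /off -/b; case: eqP => [->|_].
    by rewrite Ec pos_id; lia.
  by rewrite mul0r add0r.
pose u := zmono x (fun i => off (fun i => pos (- b' i j)) i - pos (- b i j)).
have Edn : exch_dn (mutate S l) j = prime_var S l ^+ c * (u * exch_dn S j).
  rewrite /u /exch_dn -zmonoD // /zmono -/b' (bigD1 (lshift k l)) //=.
  rewrite [in RHS](bigD1 (lshift k l)) //= /off eqxx Eb'l opprK Ec.
  rewrite sub0r addNr expr0z mul1r pos_id // -exprnP; congr (_ * _).
  apply: eq_bigr => i il; rewrite mutate_var // (negbTE il) -/b; congr (_ ^ _); lia.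
have Eup : exch_up (mutate S l) j = u * A0 * exch_up S l ^+ c.
  rewrite /exch_up (eq_zmono_off (x' := x)) => [|i]; last first.
    have [->|il] := eqVneq i (lshift k l); last by left; rewrite mutate_var.
    by right; rewrite -/b' Eb'l pos_eq0; lia.
  rewrite zmonoXn /u /A0 -!zmonoD //; apply: eq_zmono => i; rewrite /off -/b' -/b.
  have [->|il] := eqVneq i (lshift k l).
    by rewrite Eb'l Ec bll (pos_eq0 (z := 0)) // !pos_eq0; lia.
  by have := posE (b' i j); have := posE (b i j); have := Eb' i il; lia.
pose M := mixed S [set l; j].
have Mx i : M (x i) by apply: mixed_var.
have MA0 : M A0.
  by apply: mixed_zmono => i _; rewrite /off; case: eqP => // _; apply: pos_ge0.
have Mu : M u.
  apply: mixed_zmono => i /set2P[->|->]; rewrite /off ?eqxx ?(negbTE jl').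
    by rewrite -/b Ec pos_eq0; lia.
  have b'jj : b' (lshift k j) j = 0.
    by rewrite Eb' // bjj pos_eq0; lia.
  by rewrite b'jj bjj subrr.
pose D := zmono x (fun i => pos (- b i l) - (i == lshift k j)%:Z).
have MD : M D.
  apply: mixed_zmono => i _; case: eqP => [->|_]; last by rewrite subr0; apply: pos_ge0.
  by rewrite pos_id; lia.
have ED : exch_dn S l = x (lshift k j) * D.
  by rewrite -(zmono1 x) /D -zmonoD //; apply: eq_zmono => i; rewrite addrC subrK.
have [Q MQ EQ] : exists2 Q, M Q & exch S l ^+ c - exch_up S l ^+ c = exch_dn S l * Q.
  rewrite subrXX; set Q := (X in _ * X); exists Q.
    apply: subring_gen_sum => i _; apply: Subring_mul; apply: subring_genX.
      exact: mixed_exch.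
    exact: mixed_up.
  by rewrite /exch [_ + exch_dn S l]addrC addrK.
have Ej : x (lshift k j) * prime_var S j = x (lshift k l) ^+ c * A0 + exch_dn S j.
  by rewrite prime_varE mulVKf // -EA.
have El : exch S l = x (lshift k l) * prime_var S l by rewrite prime_varE mulVKf.
suff -> : prime_var (mutate S l) j = u * (prime_var S l ^+ c * prime_var S j - A0 * (D * Q)).
  apply: Subring_mul => //; apply: Subring_sub.
    by apply: Subring_mul; [apply: subring_genX|]; apply: mixed_prime.
  by do !apply: Subring_mul.
rewrite prime_varE mutate_var //; apply: (mulfI (x0 (lshift k j))).
rewrite mulVKf // /exch Eup Edn.
have dnE : exch_dn S j = x (lshift k j) * prime_var S j - x (lshift k l) ^+ c * A0.
  by rewrite Ej addrC addKr.
have upE : exch_up S l ^+ c =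
    x (lshift k l) ^+ c * prime_var S l ^+ c - x (lshift k j) * D * Q.
  by rewrite -ED -EQ El exprMn opprB addrC subrK.
by rewrite dnE upE; ring.
Qed.

Lemma second_prime S l j : alg_indep (svar S) -> sign_skew S -> j != l ->
  mixed S [set l; j] (prime_var (mutate S l) j).
Proof.
move=> hx sS jl; have [h|h|h] := ltrgtP (smat S (lshift k l) j) 0.
- apply: opposite_mixed; rewrite -opposite_prime -opposite_mutate.
  apply: second_prime_pos => //; first exact: opposite_sign_skew.
  by rewrite mxE oppr_gt0.
- exact: second_prime_pos.
have -> : prime_var (mutate S l) j = prime_var S j; last exact: mixed_prime.
have ljl : lshift k j != lshift k l by rewrite (inj_eq (@lshift_inj _ _)).
rewrite !prime_varE mutate_var //; congr (_ * _).
have E i : smat (mutate S l) i j = smat S i j.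
  rewrite mutate_mat (negbTE jl) orbF h; case: eqP => [->|_]; first by rewrite h oppr0.
  by rewrite oppr0 (pos_eq0 (z := 0)) // !mulr0 !(subrr, addr0).
congr (_ + _); (rewrite /exch_up /exch_dn (eq_zmono_off (x' := svar S)) => [|i];
  [by apply: eq_zmono => i; rewrite E | rewrite E]);
  have [->|il] := eqVneq i (lshift k l); do ?[by right; rewrite h];
  by left; rewrite mutate_var.
Qed.

Lemma mixed_mutate S (T : {set 'I_n}) l z : alg_indep (svar S) -> sign_skew S ->
  (forall j, j \in T -> j = l \/ mixed S T (prime_var (mutate S l) j)) ->
  l \in T -> mixed (mutate S l) T z -> mixed S T z.
Proof.
move=> hx sS hT lT; apply: subring_gen_sub => {}z [[i ->]|[i h ->]|[j jT ->]].
- have [->|il] := eqVneq i (lshift k l); first exact: mixed_prime.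
  by rewrite mutate_var //; apply: mixed_var.
- by rewrite mutate_var; [apply: mixed_inv | apply: h].
- case: (hT _ jT) => [->|//]; rewrite prime_var_mutate //; exact: mixed_var.
Qed.

Definition upper S z := mixed S set0 z /\ forall j, mixed S [set j] z.

Lemma pair_acyclic S l j : sign_skew S -> acyclic_on S [set l; j].
Proof.
move=> sS; have d i : smat S (lshift k i) i = 0 by apply: sign_skew_diag.
have [h|h] := lerP (smat S (lshift k l) j) 0.
  exists (fun i => (i == l) : nat) => a c;
    move=> /set2P[->|->] /set2P[->|->]; rewrite ?d ?ltxx ?eqxx //.
    by move=> h'; lia.
  by case: eqP => [->|//]; rewrite d ltxx.
exists (fun i => (i == j) : nat) => a c;
    move=> /set2P[->|->] /set2P[->|->]; rewrite ?d ?ltxx ?eqxx //.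
  by case: eqP => [->|//]; rewrite d ltxx.
by have [[]|[]|[]] := sign_skew_pair l j sS; lia.
Qed.

(** Each condition for [S] follows from the rank two algebra that combines it
    with the direction of mutation, because that algebra is stable under
    the mutation. *)
Lemma upper_mutate S l z : alg_indep (svar S) -> sign_skew S -> sign_skew (mutate S l) ->
  full_rank S -> upper (mutate S l) z -> upper S z.
Proof.
move=> hx sS sS' fr [M0 Mz].
have hx' : alg_indep (svar (mutate S l)) by apply: mutate_indep.
have fr' : full_rank (mutate S l) by apply: mutate_full_rank.
have Ml : mixed S [set l] z.
  by apply: (@mixed_mutate _ _ l) (Mz l) => // [j /set1P->|]; [left | apply: set11].
split; first by apply: mixedS Ml; apply: sub0set.
move=> j; have [->|jl] := eqVneq j l; first by [].
apply: (@mixedS _ _ _ _ [set l; j]); first by rewrite sub1set !inE eqxx orbT.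
apply: (@mixed_mutate _ _ l) => //; last first.
- apply: (mixed_intersection hx' sS' fr') => //; exact: pair_acyclic.
- by rewrite !inE eqxx.
- by move=> i /set2P[->|->]; [left | right; apply: second_prime].
Qed.

Definition always_sign_skew S := forall ls, well_defined S ls.

Lemma always_sign_skew1 S l : always_sign_skew S -> sign_skew (mutate S l).
Proof. by move=> /(_ [:: l])[]. Qed.

Lemma always_sign_skewS S l : always_sign_skew S -> always_sign_skew (mutate S l).
Proof. by move=> tS ls; have [] := tS (l :: ls). Qed.

Lemma cluster_variable_upper S ls i : alg_indep (svar S) -> sign_skew S -> always_sign_skew S ->
  full_rank S -> upper S (svar (mutates S ls) i).
Proof.
elim: ls S => [|l ls IH] S hx sS tS fr.
  by split=> [|j]; apply: mixed_var.
have sS' := always_sign_skew1 l tS.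
apply: (@upper_mutate _ l) => //; apply: IH => //.
- exact: mutate_indep.
- exact: always_sign_skewS.
- exact: mutate_full_rank.
Qed.

(** A cluster variable lies in the upper bound of its own seed, hence in that of
    [S]; for an acyclic seed the upper bound is the lower bound. *)
Theorem cluster_variable_lower_full_rank S ls i :
  alg_indep (svar S) -> sign_skew S -> always_sign_skew S -> full_rank S -> acyclic_on S setT ->
  mixed S setT (svar (mutates S ls) i).
Proof.
move=> hx sS tS fr aS; have [M0 Mz] := cluster_variable_upper ls i hx sS tS fr.
by apply: mixed_intersection.
Qed.

End UpperBound.

(** * Framing and specialization of the added frozen variables *)
Section Acyclic.
Variables (n k : nat) (S : preseed n k).

(** Counting ancestors gives a rank that increases along the arrows. *)
Lemma acyclic_seed_rank : acyclic_seed S -> acyclic_on S setT.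
Proof.
move=> aS; pose e := arrow (principal (smat S)).
exists (fun i => #|[set j | connect e j i]|) => l l' _ _ ll'.
have ell' : e l l' by rewrite /e arrowE.
apply: proper_card; apply/properP; split.
  apply/subsetP => j; rewrite !inE => jl.
  by apply: connect_trans jl _; apply: connect1.
exists l'; rewrite !inE ?connect0 //; apply/negP => /connectP[p ep lp].
suff : l' :: p = [::] by [].
by apply: aS; rewrite /= rcons_path ep -lp.
Qed.

End Acyclic.

Section Framing.
Variables (n k : nat).
Implicit Type S : preseed n k.

Lemma split_lshift a c (l : 'I_a) : split (lshift c l) = inl l.
Proof. exact: (unsplitK (inl l)). Qed.

Lemma split_rshift a c (j : 'I_c) : split (rshift a j) = inr j.
Proof. exact: (unsplitK (inr j)). Qed.

Definition old (i : 'I_(n + k)) : 'I_(n + (k + n)) :=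
  match split i with
  | inl l => lshift (k + n) l
  | inr j => rshift n (lshift n j)
  end.

Definition new (i : 'I_n) : 'I_(n + (k + n)) := rshift n (rshift k i).

Lemma old_lshift l : old (lshift k l) = lshift (k + n) l.
Proof. by rewrite /old split_lshift. Qed.

Lemma old_rshift j : old (rshift n j) = rshift n (lshift n j).
Proof. by rewrite /old split_rshift. Qed.

Lemma old_new (P : 'I_(n + (k + n)) -> Prop) :
  (forall i, P (old i)) -> (forall i, P (new i)) -> forall r, P r.
Proof.
move=> Po Pn r; rewrite -(splitK r); case: (split r) => [l|r'] /=.
  by rewrite -old_lshift.
rewrite -(splitK r'); case: (split r') => [j|i] /=; last exact: Pn.
by rewrite -old_rshift.
Qed.

Lemma big_old_new (R : Type) (idx : R) (op : Monoid.com_law idx)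
    (f : 'I_(n + (k + n)) -> R) :
  \big[op/idx]_r f r = op (\big[op/idx]_i f (old i)) (\big[op/idx]_i f (new i)).
Proof.
rewrite !big_split_ord /= Monoid.mulmA; congr (op (op _ _) _).
  by apply: eq_bigr => i _; rewrite old_lshift.
by apply: eq_bigr => i _; rewrite old_rshift.
Qed.

Lemma old_lshiftE i l : (old i == lshift (k + n) l) = (i == lshift k l).
Proof.
rewrite -(splitK i); case: (split i) => [j|j] /=.
  by rewrite old_lshift !(inj_eq (@lshift_inj _ _)).
by rewrite old_rshift !eq_rlshift.
Qed.

(** Principal framing over the generic point: one frozen variable per mutable
    direction, joined to it by a single arrow. *)
Definition frame S : preseed n (k + n) :=
  Preseed [ffun r => FracField.tofrac 'X_r]
    (col_mx (usubmx (smat S)) (col_mx (dsubmx (smat S)) 1%:M)).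

Lemma frame_old S i j : smat (frame S) (old i) j = smat S i j.
Proof.
rewrite -(splitK i); case: (split i) => r /=.
  by rewrite old_lshift col_mxEu mxE.
by rewrite old_rshift col_mxEd col_mxEu mxE.
Qed.

Lemma frame_full_rank S : full_rank (frame S).
Proof.
move=> c hc j; have := hc (new j); rewrite (bigD1 j) //= /new col_mxEd col_mxEd.
rewrite mxE eqxx mul1r big1 ?addr0 // => i ij.
by rewrite col_mxEd col_mxEd mxE eq_sym (negbTE ij) mul0r.
Qed.

Lemma map_mpoly_intr_inj m (p : {mpoly int[m]}) :
  map_mpoly (intr : int -> rat) p = 0 -> p = 0.
Proof.
move=> p0; apply/mpolyP => e; have := congr1 (fun q : {mpoly rat[m]} => q@_e) p0.
by rewrite mcoeff_map_mpoly !mcoeff0 => /eqP; rewrite intr_eq0 => /eqP.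
Qed.

Lemma generic_indep m : alg_indep (fun i : 'I_m => FracField.tofrac 'X_i : ratfun m).
Proof.
move=> p p0; apply: map_mpoly_intr_inj; apply/eqP; rewrite -tofrac_eq0 -p0; apply/eqP.
rewrite /map_mpoly /ev /mmap raddf_sum; apply: eq_bigr => e _ /=.
rewrite tofracM rmorph_prod /= !rmorph_int; congr (_ * _).
by apply: eq_bigr => i _; rewrite tofracXn.
Qed.

Lemma frame_indep S : alg_indep (svar (frame S)).
Proof.
move=> p p0; apply: (@generic_indep _ p); rewrite -p0.
by apply: eq_bigr => e _; congr (_ * _); apply: eq_bigr => i _; rewrite ffunE.
Qed.

Lemma free_generating_indep m (y : {ffun 'I_m -> ratfun m}) :
  free_generating y -> alg_indep y.
Proof.
case=> h _ p p0; apply: map_mpoly_intr_inj; apply: h; rewrite -p0.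
pose f : {rmorphism rat -> ratfun m} := (@FracField.tofrac {mpoly rat[m]} \o @mpolyC m rat)%FUN.
rewrite -[LHS]/(mmap f y (map_mpoly intr p)) /map_mpoly [X in mmap f y X]/mmap.
rewrite raddf_sum; apply: eq_bigr => e _ /=.
rewrite mmap1_id rmorphM /= mmapC mmapX /=; congr (_ * _).
by rewrite !rmorph_int.
Qed.

Definition agree (Sh : preseed n (k + n)) S := forall i j, smat Sh (old i) j = smat S i j.

Lemma agree_principal Sh S : agree Sh S -> principal (smat Sh) = principal (smat S).
Proof.
by move=> ag; apply/matrixP => i j; rewrite !mxE -ag old_lshift.
Qed.

Lemma agree_mutate Sh S l : agree Sh S -> agree (mutate Sh l) (mutate S l).
Proof.
by move=> ag i j; rewrite !mutate_mat old_lshiftE -old_lshift !ag.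
Qed.

Lemma agree_always_sign_skew Sh S : agree Sh S -> always_sign_skew S -> always_sign_skew Sh.
Proof.
move=> ag tS ls; elim: ls Sh S ag tS => //= l ls IH Sh S ag tS.
have ag' := agree_mutate l ag; split; last by apply: IH ag' _; apply: always_sign_skewS.
by rewrite (agree_principal ag'); apply: always_sign_skew1.
Qed.

Section Specialize.
Variable S : preseed n k.
Hypotheses (indep : alg_indep (svar S)) (sS : sign_skew S) (tS : always_sign_skew S).

Definition unframe (r : 'I_(n + (k + n))) : ratfun (n + k) :=
  match split r with
  | inl l => svar S (lshift k l)
  | inr r' => if split r' is inl j then svar S (rshift n j) else 1
  end.

Lemma unframe_old i : unframe (old i) = svar S i.
Proof.
rewrite -[in RHS](splitK i) /unframe /old; case: (split i) => j.
  by rewrite split_lshift.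
by rewrite split_rshift split_lshift.
Qed.

Lemma unframe_new i : unframe (new i) = 1.
Proof. by rewrite /unframe /new !split_rshift. Qed.

Local Notation Sp := (specializes (svar (frame S)) unframe).
Let fi := @frame_indep S.

(** Invariant carried along a mutation sequence: setting the added variables to [1]
    turns the framed seed into the original one. *)
Definition unframes Sh S' :=
  [/\ forall i, Sp (svar Sh (old i)) (svar S' i),
      forall i, Sp (svar Sh (new i)) 1 & agree Sh S'].

Lemma unframes_prime Sh S' l : (forall i, svar S' i != 0) -> unframes Sh S' ->
  Sp (prime_var Sh l) (prime_var S' l).
Proof.
move=> x0 [ho hn ag].
have mon e : Sp (zmono (svar Sh) e) (zmono (svar S') (fun i => e (old i))).
  rewrite /zmono big_old_new /= -[X in Sp _ X]mulr1; apply: specializesM.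
    by apply: specializes_prod => i _; apply: (specializesXz fi).
  have -> : 1 = \prod_(i < n) (1 : ratfun (n + k)) ^ e (new i).
    by rewrite big1 // => i _; rewrite exp1rz.
  by apply: specializes_prod => i _; apply: (specializesXz fi); rewrite ?oner_neq0.
rewrite !prime_varE; apply: specializesM.
  by rewrite -old_lshift; apply: (specializesV fi).
apply: specializesD.
  by have := mon (fun i => pos (smat Sh i l)); congr Sp; apply: eq_zmono => i; rewrite ag.
by have := mon (fun i => pos (- smat Sh i l)); congr Sp; apply: eq_zmono => i; rewrite ag.
Qed.

Lemma unframes_mutate Sh S' l : (forall i, svar S' i != 0) -> unframes Sh S' ->
  unframes (mutate Sh l) (mutate S' l).
Proof.
move=> x0 uf; have [ho hn ag] := uf; split; last exact: agree_mutate.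
  move=> i; have [->|il] := eqVneq i (lshift k l).
    by rewrite old_lshift; apply: unframes_prime.
  by rewrite !mutate_var // old_lshiftE.
by move=> i; rewrite mutate_var // /new eq_rlshift.
Qed.

Lemma unframes_mutates Sh S' ls : alg_indep (svar S') -> sign_skew S' -> always_sign_skew S' ->
  unframes Sh S' -> unframes (mutates Sh ls) (mutates S' ls).
Proof.
elim: ls Sh S' => //= l ls IH Sh S' hx sS' tS' uf.
apply: IH; [exact: mutate_indep | exact: always_sign_skew1 | exact: always_sign_skewS |].
by apply: unframes_mutate => // i; apply: alg_indep_neq0.
Qed.

Lemma unframes_frame : unframes (frame S) S.
Proof.
split; last exact: frame_old.
  by move=> i; rewrite -unframe_old; apply: specializes_var.
by move=> i; rewrite -(unframe_new i); apply: specializes_var.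
Qed.

Lemma unframes_mixed z : mixed (frame S) setT z ->
  exists2 w, mixed S setT w & Sp z w.
Proof.
have x0 i : svar S i != 0 by apply: alg_indep_neq0.
elim=> {z} [z|||].
- case=> [[r ->]|[r hr ->]|[l _ ->]].
  + exists (unframe r); last exact: specializes_var.
    elim/old_new: r => i; first by rewrite unframe_old; apply: mixed_var.
    by rewrite unframe_new; apply: Subring_one.
  + exists (unframe r)^-1.
      elim/old_new: r hr => i hi; last by rewrite unframe_new invr1; apply: Subring_one.
      rewrite unframe_old; apply: mixed_inv => l lT.
      by rewrite -old_lshiftE; apply: hi.
    apply: (specializesV fi); first exact: specializes_var.
    by elim/old_new: r hr => i _; rewrite ?unframe_old ?unframe_new ?oner_neq0.
  + exists (prime_var S l); first exact: mixed_prime.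
    by apply: unframes_prime => //; apply: unframes_frame.
- by exists 1; [apply: Subring_one | apply: specializes1].
- move=> y z _ [y' My hy] _ [z' Mz hz]; exists (y' - z'); first exact: Subring_sub.
  exact: specializesB.
- move=> y z _ [y' My hy] _ [z' Mz hz]; exists (y' * z'); first exact: Subring_mul.
  exact: specializesM.
Qed.

(** The framed seed has full rank, so its cluster variables are polynomials in
    the initial ones and their primes; setting the added frozen variables to [1]
    turns this into the same assertion for [S]. *)
Theorem cluster_variable_lower ls i : acyclic_on S setT ->
  mixed S setT (svar (mutates S ls) i).
Proof.
move=> [rk hrk].
have ag : agree (frame S) S := @frame_old S.
have sF : sign_skew (frame S) by rewrite /sign_skew (agree_principal ag).
have aF : acyclic_on (frame S) setT.
  by exists rk => l l' lT l'T; rewrite -old_lshift ag; apply: hrk.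
have tF : always_sign_skew (frame S) by apply: agree_always_sign_skew ag tS.
have M := cluster_variable_lower_full_rank ls (old i) fi sF tF (@frame_full_rank S) aF.
have [w Mw Sw] := unframes_mixed M.
have [So _ _] := unframes_mutates ls indep sS tS unframes_frame.
by rewrite (specializes_functional fi (So i) Sw).
Qed.

End Specialize.
End Framing.

(** * Factorization of the elements xtilde *)
Section Layers.
Variables (n k : nat) (S : preseed n k).
Hypotheses (indep : alg_indep (svar S)) (sS : sign_skew S).
Local Notation x := (svar S).
Local Notation b := (smat S).
Let x0 i : x i != 0 := alg_indep_neq0 indep i.

(** The two terms of [x_l']: the entry [true] of a sequence selects the outgoing
    monomial, [false] the incoming one. *)
Definition half_prime l (c : bool) : ratfun (n + k) :=
  (x (lshift k l))^-1 * (if c then exch_dn S l else exch_up S l).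

Definition gcc (I U : {set 'I_n}) : bool :=
  [forall i in I, forall j in I,
     arrow (principal b) i j ==> ~~ ((i \in U) && (j \notin U))].

(** The element [xtilde S a] for the indicator function [a] of [I]. *)
Definition layer (I : {set 'I_n}) : ratfun (n + k) :=
  \sum_(U : {set 'I_n} | (U \subset I) && gcc I U) \prod_(i in I) half_prime i (i \in U).

Lemma half_prime_zmono i (c : bool) : half_prime i c =
  zmono x (fun r => pos (if c then - b r i else b r i) - (r == lshift k i)%:Z).
Proof.
rewrite zmonoD // zmonoN // zmono1 /half_prime mulrC; congr (_ * _).
by case: c.
Qed.

Implicit Type a : {ffun 'I_n -> int}.
Definition level a (r : nat) : {set 'I_n} := [set i | (r < absz (pos (a i)))%N].

Lemma ext_mat_col i l : ext_mat b i (lshift k l) = b i l.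
Proof.
rewrite -(splitK i) /ext_mat; case: (split i) => j /=.
  by rewrite block_mxEul mxE.
by rewrite block_mxEdl mxE.
Qed.

Lemma ext_mat_row_gt0 l i :
  (0 < ext_mat b (lshift k l) i) = (b i l < 0).
Proof.
rewrite -(splitK i) /ext_mat; case: (split i) => j /=.
  rewrite block_mxEul mxE; have [[-> ->]|[]|[]] := sign_skew_pair l j sS; lia.
by rewrite block_mxEur !mxE oppr_gt0.
Qed.

Lemma prod_half_prime l (t : seq bool) :
  \prod_(c <- t) half_prime l c = (x (lshift k l))^-1 ^+ size t *
    (exch_up S l ^+ seq_weight (seq_compl t) * exch_dn S l ^+ seq_weight t).
Proof.
elim: t => [|c t IH]; first by rewrite /seq_weight !big_nil !expr0 !mulr1.
rewrite big_cons IH /seq_weight /= !big_cons !exprD exprS /half_prime.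
by case: c => /=; rewrite ?expr0 ?expr1 ?mul1r; ring.
Qed.

(** Regrouping the arrows by their head for the entries [false] and by their tail for
    the entries [true] gives one power of each exchange monomial per direction. *)
Lemma inner_product a (s : S_all a) :
  \prod_(e : 'I_(n + k) * 'I_(n + k) | arrow (ext_mat b) e.1 e.2)
      (x e.1 ^ (ext_mat b e.1 e.2 * (seq_weight (seq_compl (ext_seq s e.2)))%:Z) *
       x e.2 ^ (- ext_mat b e.2 e.1 * (seq_weight (ext_seq s e.1))%:Z)) =
  \prod_(l < n) (exch_up S l ^+ seq_weight (seq_compl (s l)) * exch_dn S l ^+ seq_weight (s l)).
Proof.
have wnil : seq_weight [::] = 0%N by rewrite /seq_weight big_nil.
have ext_l l : ext_seq s (lshift k l) = s l by rewrite /ext_seq split_lshift.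
have ext_r j : ext_seq s (rshift n j) = [::] by rewrite /ext_seq split_rshift.
rewrite !big_split /=; congr (_ * _); rewrite big_mkcond /=.
  rewrite -(pair_bigA _ (fun i j => if arrow (ext_mat b) i j then
    x i ^ (ext_mat b i j * (seq_weight (seq_compl (ext_seq s j)))%:Z) else 1)) /=.
  rewrite exchange_big big_split_ord /= [X in _ * X]big1 ?mulr1; last first.
    move=> j _; rewrite big1 // => i _; rewrite ext_r /= wnil mulr0 expr0z.
    by case: ifP.
  apply: eq_bigr => l _; rewrite zmonoXn; apply: eq_bigr => i _.
  rewrite /arrow /= ext_mat_col ext_l; move: (seq_weight _) => wt.
  case: ltrP => h; first by rewrite pos_id //; lia.
  by rewrite pos_eq0 // mul0r.
rewrite -(pair_bigA _ (fun i j => if arrow (ext_mat b) i j then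
    x j ^ (- ext_mat b j i * (seq_weight (ext_seq s i))%:Z) else 1)) /=.
rewrite big_split_ord /= [X in _ * X]big1 ?mulr1; last first.
  move=> j _; rewrite big1 // => i _; rewrite ext_r /= wnil mulr0 expr0z.
  by case: ifP.
apply: eq_bigr => l _; rewrite zmonoXn; apply: eq_bigr => i _.
rewrite /arrow /= ext_mat_row_gt0 ext_mat_col ext_l.
move: (seq_weight _) => wt; case: ltrP => h.
  by rewrite pos_id //; lia.
by rewrite pos_eq0 ?mul0r //; lia.
Qed.

Section Factor.
Variables (a : {ffun 'I_n -> int}) (D : nat).
Hypothesis aD : forall i, (absz (pos (a i)) <= D)%N.

(** A family of sequences is the same as the list of its sections at each position,
    and the section at position [r] is a subset of [level a r]. *)
Let slices (s : S_all a) : {ffun 'I_D -> {set 'I_n}} :=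
  [ffun r : 'I_D => [set i : 'I_n in level a r | nth false (s i) r]].
Let stack (f : {ffun 'I_D -> {set 'I_n}}) : S_all a :=
  finfun (fun i => [tuple i \in f (widen_ord (aD i) r) | r < absz (pos (a i))]).

Let stackK (f : {ffun 'I_D -> {set 'I_n}}) :
  (forall r, f r \subset level a r) -> slices (stack f) = f.
Proof.
move=> fl; apply/ffunP => r; apply/setP => i; rewrite !ffunE !inE.
case: ltnP => h /=.
  rewrite -[nat_of_ord r]/(nat_of_ord (Ordinal h)) -tnth_nth /stack ffunE tnth_mktuple.
  by congr (_ \in f _); apply: val_inj.
by apply/esym/negP => /(subsetP (fl r)); rewrite inE ltnNge h.
Qed.

Let slicesK s : stack (slices s) = s.
Proof.
apply/ffunP => i; rewrite ffunE; apply: eq_from_tnth => r.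
by rewrite tnth_mktuple ffunE !inE (tnth_nth false) /= ltn_ord.
Qed.

Let slices_gcc s :
  (s \in S_gcc b a) =
  [forall r, (slices s r \subset level a r) && gcc (level a r) (slices s r)].
Proof.
rewrite inE; apply/forallP/forallP => [h r|h i].
  apply/andP; split; first by rewrite ffunE; apply/subsetP => i; rewrite !inE => /andP[].
  apply/forall_inP => i; rewrite inE => ir; apply/forall_inP => j; rewrite inE => jr.
  apply/implyP => ij; rewrite !ffunE !inE ir jr /=.
  have /forallP/(_ j) := h i; rewrite ij /= sum_nat_eq0 => /forallP hh.
  have rm : (r < minn (size (s i)) (size (seq_compl (s j))))%N.
    by rewrite size_map !size_tuple leq_min ir jr.
  have := hh (Ordinal rm); rewrite /= (nth_map false) ?size_tuple //.
  by case: (nth _ _ _) => //; case: (nth _ _ _).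
apply/forallP => j; apply/implyP => ij; rewrite sum_nat_eq0; apply/forallP => -[r rm] /=.
move: rm; rewrite size_map !size_tuple leq_min => /andP[ir jr].
rewrite (nth_map false) ?size_tuple //.
have /andP[_ /forall_inP/(_ i)] := h (Ordinal (leq_trans ir (aD i))).
rewrite inE => /(_ ir)/forall_inP/(_ j); rewrite inE => /(_ jr)/implyP/(_ ij).
by rewrite !ffunE !inE ir jr /=; case: (nth _ _ _) => //; case: (nth _ _ _).
Qed.

(** The compatibility condition never relates different positions of the
    sequences, so the sum over all compatible families is a product of sums, one
    for each position. *)
Lemma xtilde_layers : xtilde S a =
  (\prod_l x (lshift k l) ^ pos (- a l)) * \prod_(r < D) layer (level a r).
Proof.
rewrite /xtilde /layer.
rewrite bigA_distr_big_dep.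
rewrite (reindex_onto slices stack) => [|f /familyP hf]; last first.
  by apply: stackK => r; have := hf r; rewrite unfold_in => /andP[].
rewrite !mulr_sumr.
apply: eq_big => [s|s _].
  rewrite slicesK eqxx andbT slices_gcc; apply/forallP/familyP => h r;
    by have := h r; rewrite unfold_in.
rewrite inner_product (exchange_big_dep xpredT) //=.
rewrite -!big_split; apply: eq_bigr => l _ /=.
have -> : x (lshift k l) ^ (- a l) =
    x (lshift k l) ^ pos (- a l) * x (lshift k l) ^ (- (absz (pos (a l)))%:Z).
  by rewrite -expfzDr //; congr (_ ^ _); rewrite /pos; lia.
rewrite -mulrA; congr (_ * _).
transitivity (\prod_(c <- s l) half_prime l c).
  by rewrite prod_half_prime size_tuple -exprz_inv.
rewrite (big_nth false) big_mkord size_tuple.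
rewrite (big_ord_widen _ (fun r => half_prime l (nth false (s l) r)) (aD l)).
apply: eq_big => [r|r h]; first by rewrite inE.
by rewrite ffunE !inE h.
Qed.

End Factor.
End Layers.

(** * Degree in the primed variables and spanning *)
Section Spanning.
Variables (n k : nat) (S : preseed n k).
Hypotheses (indep : alg_indep (svar S)) (sS : sign_skew S).
Local Notation x := (svar S).
Local Notation b := (smat S).
Let x0 i : x i != 0 := alg_indep_neq0 indep i.

Definition xmono (u : 'I_n -> nat) := \prod_l x (lshift k l) ^+ u l.
Definition pmono (v : 'I_n -> nat) := \prod_l prime_var S l ^+ v l.

(** The bound is strict so that an element can be smaller than a leading part of
    degree [0]. *)
Inductive prime_deg_lt : nat -> ratfun (n + k) -> Prop :=
| PrimeDeg0 d : prime_deg_lt d 0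
| PrimeDegD d y z : prime_deg_lt d y -> prime_deg_lt d z -> prime_deg_lt d (y + z)
| PrimeDegMono d c u v : ZP S c -> (\sum_l v l < d)%N ->
    prime_deg_lt d (c * (xmono u * pmono v)).

Lemma pdeg_le d e z : (d <= e)%N -> prime_deg_lt d z -> prime_deg_lt e z.
Proof.
move=> de h; elim: h de => {d z} [d|d y z _ IHy _ IHz|d c u v Zc vd] de.
- exact: PrimeDeg0.
- by apply: PrimeDegD; [apply: IHy | apply: IHz].
- by apply: PrimeDegMono => //; apply: leq_trans de.
Qed.

Lemma xmonoD u u' : xmono (fun l => u l + u' l)%N = xmono u * xmono u'.
Proof. by rewrite /xmono -big_split; apply: eq_bigr => l _; rewrite exprD. Qed.

Lemma pmonoD u u' : pmono (fun l => u l + u' l)%N = pmono u * pmono u'.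
Proof. by rewrite /pmono -big_split; apply: eq_bigr => l _; rewrite exprD. Qed.

Lemma xmono0 : xmono (fun=> 0%N) = 1.
Proof. by rewrite /xmono big1. Qed.

Lemma pmono0 : pmono (fun=> 0%N) = 1.
Proof. by rewrite /pmono big1. Qed.

Lemma xmono1 l : xmono (fun i => (i == l) : nat) = x (lshift k l).
Proof.
by rewrite /xmono (bigD1 l) //= eqxx expr1 big1 ?mulr1 // => i /negbTE->.
Qed.

Lemma pmono1 l : pmono (fun i => (i == l) : nat) = prime_var S l.
Proof.
by rewrite /pmono (bigD1 l) //= eqxx expr1 big1 ?mulr1 // => i /negbTE->.
Qed.

Lemma pdegM d e y z :
  prime_deg_lt d.+1 y -> prime_deg_lt e z -> prime_deg_lt (d + e) (y * z).
Proof.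
move Ed: d.+1 => d' hy; elim: hy Ed => {d' y} [d1|d1 y y' _ IHy _ IHy'|d1 c u v Zc vd] Ed hz.
- by rewrite mul0r; apply: PrimeDeg0.
- by rewrite mulrDl; apply: PrimeDegD; [apply: IHy | apply: IHy'].
rewrite -Ed ltnS in vd; elim: hz => {e z} [e|e y z _ IHy _ IHz|e c' u' v' Zc' v'e].
- by rewrite mulr0; apply: PrimeDeg0.
- by rewrite mulrDr; apply: PrimeDegD.
rewrite mulrACA (mulrACA (xmono u)) -xmonoD -pmonoD; apply: PrimeDegMono.
  exact: Subring_mul.
by rewrite big_split /= -addnS; apply: leq_add.
Qed.

Lemma pdeg_ZP c : ZP S c -> prime_deg_lt 1 c.
Proof.
move=> Zc; rewrite (_ : c = c * (xmono (fun=> 0%N) * pmono (fun=> 0%N))).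
  by apply: PrimeDegMono => //; rewrite big1.
by rewrite xmono0 pmono0 !mulr1.
Qed.

Lemma pdeg1 : prime_deg_lt 1 1.
Proof. by apply: pdeg_ZP; apply: Subring_one. Qed.

Lemma pdegZ d c z : ZP S c -> prime_deg_lt d z -> prime_deg_lt d (c * z).
Proof. by move=> Zc hz; have := pdegM (pdeg_ZP Zc) hz. Qed.

Lemma pdegB d y z : prime_deg_lt d y -> prime_deg_lt d z -> prime_deg_lt d (y - z).
Proof.
move=> hy hz; apply: PrimeDegD => //; rewrite -mulN1r; apply: pdegZ => //.
by apply: subring_genN; apply: Subring_one.
Qed.

Lemma pdeg_zmono e : (forall l, 0 <= e (lshift k l)) -> prime_deg_lt 1 (zmono x e).
Proof.
move=> e0; rewrite /zmono big_split_ord /= mulrC.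
have -> : \prod_(l < n) x (lshift k l) ^ e (lshift k l) =
    xmono (fun l => absz (e (lshift k l))) * pmono (fun=> 0%N).
  rewrite pmono0 mulr1; apply: eq_bigr => l _.
  by rewrite exprnP; congr (_ ^ _); have := e0 l; lia.
apply: PrimeDegMono; last by rewrite big1.
apply: subring_gen_prod => j _; apply: subring_genXz_unit;
  apply: Subring_gen; exists j; [left | right] => //.
Qed.

Lemma pdeg_exch l : prime_deg_lt 1 (exch S l).
Proof. by apply: PrimeDegD; apply: pdeg_zmono => i; apply: pos_ge0. Qed.

Lemma pdeg_prime l : prime_deg_lt 2 (prime_var S l).
Proof.
rewrite -pmono1 -[pmono _]mul1r -xmono0 -[X in prime_deg_lt _ X]mul1r.
apply: PrimeDegMono; first exact: Subring_one.
by rewrite (bigD1 l) //= eqxx big1 // => i /negbTE->.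
Qed.

Lemma pdeg_var i : prime_deg_lt 1 (x i).
Proof. by rewrite -(zmono1 x); apply: pdeg_zmono => l; lia. Qed.

Lemma mixed_pdeg z : mixed S setT z -> exists d, prime_deg_lt d z.
Proof.
elim=> {z} [z [[i ->]|[i h ->]|[l _ ->]]||y z _ [d hy] _ [e hz]|y z _ [d hy] _ [e hz]].
- by exists 1%N; apply: pdeg_var.
- exists 1%N; apply: pdeg_ZP; rewrite -(splitK i) in h *; case: (split i) h => j /= h.
    by have := h j (in_setT j); rewrite eqxx.
  by apply: Subring_gen; exists j; right.
- by exists 2; apply: pdeg_prime.
- by exists 1%N; apply: pdeg1.
- by exists (d + e)%N; apply: pdegB; [apply: pdeg_le hy | apply: pdeg_le hz]; lia.
- by exists (d + e)%N; apply: pdegM => //; apply: pdeg_le hy.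
Qed.

Lemma pdeg_mixed d z : prime_deg_lt d z -> mixed S setT z.
Proof.
elim=> {d z} [d|d y z _ ? _ ?|d c u v Zc _]; [exact: subring_gen0 | exact: subring_genD | ].
apply: Subring_mul.
  move: Zc; apply: subring_gen_sub => {}z [j [->|->]]; first exact: mixed_var.
  by apply: mixed_inv => l _; rewrite eq_rlshift.
by apply: Subring_mul; apply: subring_gen_prod => l _; apply: subring_genX;
  [apply: mixed_var | apply: mixed_prime].
Qed.

(** The leading part of a product is the product of the leading parts. *)
Lemma pdeg_prod I (r : seq I) (d : I -> nat) (f g : I -> ratfun (n + k)) :
  (forall i, prime_deg_lt (d i).+1 (f i)) -> (forall i, prime_deg_lt (d i) (g i - f i)) ->
  prime_deg_lt (\sum_(i <- r) d i) (\prod_(i <- r) g i - \prod_(i <- r) f i) /\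
  prime_deg_lt (\sum_(i <- r) d i).+1 (\prod_(i <- r) f i).
Proof.
move=> hf hgf; elim: r => [|i r [IH IHf]].
  by rewrite !big_nil subrr; split; [apply: PrimeDeg0 | apply: pdeg1].
rewrite !big_cons; split; last by rewrite -addnS; apply: pdegM.
have -> : g i * \prod_(j <- r) g j - f i * \prod_(j <- r) f j =
    (\prod_(j <- r) g j) * (g i - f i) + f i * (\prod_(j <- r) g j - \prod_(j <- r) f j).
  by rewrite !mulrBr addrA [_ * g i]mulrC [_ * f i]mulrC subrK.
apply: PrimeDegD; last exact: pdegM.
rewrite addnC; apply: pdegM => //.
rewrite -[\prod_(j <- r) g j](subrK (\prod_(j <- r) f j)); apply: PrimeDegD => //.
exact: pdeg_le IH.
Qed.

Lemma sum_mem (T : finType) (A : {set T}) : (\sum_i (i \in A : nat) = #|A|)%N.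
Proof. by rewrite -sum1_card [RHS]big_mkcond; apply: eq_bigr => i _; case: ifP. Qed.

Lemma pdeg_primes (J : {set 'I_n}) :
  prime_deg_lt #|J|.+1 (\prod_(i in J) prime_var S i).
Proof.
pose f i := if i \in J then prime_var S i else 1.
have hf i : prime_deg_lt (i \in J : nat).+1 (f i).
  by rewrite /f; case: ifP => _; [apply: pdeg_prime | apply: pdeg1].
have hff i : prime_deg_lt (i \in J : nat) (f i - f i) by rewrite subrr; apply: PrimeDeg0.
by have [_] := pdeg_prod (index_enum _) hf hff; rewrite sum_mem /f -big_mkcond.
Qed.

Section LayerDegree.
Variable I : {set 'I_n}.

Let comp (U : {set 'I_n}) (e : 'I_n * 'I_n) := ~~ ((e.1 \in U) && (e.2 \notin U)).

(** Inclusion-exclusion over the arrows, one arrow at a time: [C1] and [C0] collect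
    the tails and heads of the arrows required to be violated, where the
    choice is forced. *)
Let inside (C0 : {set 'I_n}) i :=
  if (i \in I) && (i \notin C0) then half_prime S i true else 0.
Let outside (C1 : {set 'I_n}) i :=
  if i \in I then if i \in C1 then 0 else half_prime S i false else 1.
Let partial_layer (E : seq ('I_n * 'I_n)) (C1 C0 : {set 'I_n}) :=
  \sum_(U : {set 'I_n} | all (comp U) E)
    \prod_i (if i \in U then inside C0 i else outside C1 i).

Let partial_layer_cons e E (C1 C0 : {set 'I_n}) : e.1 \in I -> e.2 \in I ->
  partial_layer (e :: E) C1 C0 =
  partial_layer E C1 C0 - partial_layer E (e.1 |: C1) (e.2 |: C0).
Proof.
move=> e1 e2; apply: (canRL (addrK _)).
rewrite /partial_layer [RHS](bigID (fun U : {set 'I_n} => comp U e)) /=.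
congr (_ + _); first by apply: eq_bigl => U; rewrite andbC.
rewrite [LHS](bigID (fun U : {set 'I_n} => comp U e)) /=.
rewrite [X in X + _]big1 ?add0r => [|U /andP[_]].
  apply: eq_bigr => U /andP[_]; rewrite negbK => /andP[U1 U2]; apply: eq_bigr => i _.
  rewrite /inside /outside !inE; case: ifP => iU.
    by case: eqP => [E2|//]; rewrite -E2 iU in U2.
  by case: eqP => [E1|//]; rewrite E1 U1 in iU.
rewrite /comp negb_and negbK => /orP[h|h].
  by rewrite (bigD1 e.1) //= (negbTE h) /outside e1 setU11 mul0r.
by rewrite (bigD1 e.2) //= h /inside e2 setU11 mul0r.
Qed.

Let saturated (C1 C0 : {set 'I_n}) :=
  [/\ C1 \subset I, C0 \subset I,
   forall i, i \in C1 -> exists2 j, j \in C0 & 0 < b (lshift k i) j &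
   forall j, j \in C0 -> exists2 i, i \in C1 & 0 < b (lshift k i) j].

(** The forced factors have no denominator: a vertex with a forced choice has
    a neighbour forced the other way, whose monomial its variable divides. *)
Let pdeg_partial_nil C1 C0 : saturated C1 C0 ->
  prime_deg_lt #|I :\: (C1 :|: C0)|.+1 (partial_layer [::] C1 C0).
Proof.
case=> /subsetP s1 /subsetP s0 h1 h0; rewrite /partial_layer /=.
rewrite (eq_bigl (fun U : {set 'I_n} => U \in {set 'I_n})) // -bigA_distr.
have [/existsP[i /andP[i1 i0]]|disj] := boolP [exists i, (i \in C1) && (i \in C0)].
  rewrite (bigD1 i) //= /inside /outside i1 i0 s1 //= addr0 mul0r; exact: PrimeDeg0.
have -> : \prod_i (inside C0 i + outside C1 i) =
  \prod_(i in C1 :|: C0) half_prime S i (i \in C1) *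
  \prod_(i in I :\: (C1 :|: C0)) prime_var S i.
  rewrite [LHS](bigID (mem (C1 :|: C0))) /=; congr (_ * _).
    apply: eq_bigr => i; rewrite /inside /outside !inE => iC.
    have iI : i \in I by case/orP: iC => /[dup] [/s1|/s0].
    have := existsPn disj i; rewrite iI; case: (i \in C1) iC => /= [_ ->|-> _].
      by rewrite addr0.
    by rewrite add0r.
  rewrite [LHS]big_mkcond [RHS]big_mkcond; apply: eq_bigr => i _.
  rewrite /inside /outside !inE negb_or; case: (i \in C1) => //=; case: (i \in C0) => //=.
  case: (i \in I) => //=; last by rewrite add0r.
  by rewrite /half_prime prime_varE /exch addrC mulrDr.
apply: (@pdegM 0).
  under eq_bigr do rewrite (half_prime_zmono indep).
  rewrite -zmono_prod //; apply: pdeg_zmono => j.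
  have term_ge0 i : i \in C1 :|: C0 -> i != j -> 0 <= pos (if i \in C1
      then - b (lshift k j) i else b (lshift k j) i) - (lshift k j == lshift k i)%:Z.
    move=> _ ij; rewrite (inj_eq (@lshift_inj _ _)) eq_sym (negbTE ij) subr0.
    exact: pos_ge0.
  have [jC|jC] := boolP (j \in C1 :|: C0); last first.
    by apply: sumr_ge0 => i iC; apply: term_ge0 => //; apply: contraNneq jC => <-.
  have [i [iC ij hi]] : exists i, [/\ i \in C1 :|: C0, i != j &
      0 < pos (if i \in C1 then - b (lshift k j) i else b (lshift k j) i)].
    have bjj : b (lshift k j) j = 0 by apply: sign_skew_diag.
    case/setUP: jC => [/h1[i i0 ji]|/h0[i i1 ij]]; exists i.
      have := existsPn disj i; rewrite i0 andbT => /negbTE i1.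
      rewrite !inE i0 orbT i1; split=> //; last by rewrite pos_id; lia.
      by apply: contraTneq ji => ->; rewrite bjj ltxx.
    rewrite !inE i1; split=> //; first by apply: contraTneq ij => ->; rewrite bjj ltxx.
    have bji : b (lshift k j) i < 0 by have [[]|[]|[]] := sign_skew_pair i j sS; lia.
    by rewrite /= pos_id; lia.
  rewrite (bigD1 j) //= (bigD1 i) /=; last by rewrite iC.
  set t0 := \sum_(_ | _) _; have t0_ge0 : 0 <= t0.
    by apply: sumr_ge0 => i' /andP[/andP[i'C i'j] _]; apply: term_ge0.
  rewrite eqxx (inj_eq (@lshift_inj _ _)) [j == i]eq_sym (negbTE ij).
  move: (pos_ge0 (if j \in C1 then - b (lshift k j) j else b (lshift k j) j)) hi t0_ge0.
  by set p := pos _; set q := pos _; move: p q t0 => p q t0 /=; lia.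
exact: pdeg_primes.
Qed.

Let pdeg_partial E C1 C0 :
  all (fun e => [&& e.1 \in I, e.2 \in I & 0 < b (lshift k e.1) e.2]) E ->
  saturated C1 C0 -> prime_deg_lt #|I :\: (C1 :|: C0)|.+1 (partial_layer E C1 C0).
Proof.
elim: E C1 C0 => [|[i j] E IH] C1 C0 /=; first by move=> _; apply: pdeg_partial_nil.
case/andP=> /and3P[iI jI ij] EI sC; rewrite partial_layer_cons //=.
apply: pdegB; first exact: IH.
apply: (@pdeg_le (#|I :\: ((i |: C1) :|: (j |: C0))|.+1)).
  by rewrite ltnS; apply/subset_leq_card/setDS/setUSS; apply: subsetUr.
apply: IH => //; case: sC => s1 s0 h1 h0; split.
- by rewrite subUset sub1set iI.
- by rewrite subUset sub1set jI.
- move=> l /setU1P[->|/h1[l' l'0 ll']]; first by exists j; rewrite ?setU11.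
  by exists l' => //; rewrite setU1r.
- move=> l /setU1P[->|/h0[l' l'0 ll']]; first by exists i; rewrite ?setU11.
  by exists l' => //; rewrite setU1r.
Qed.

Let pdeg_partial_sub E :
  all (fun e => [&& e.1 \in I, e.2 \in I & 0 < b (lshift k e.1) e.2]) E ->
  prime_deg_lt #|I| (partial_layer E set0 set0 - \prod_(i in I) prime_var S i).
Proof.
elim: E => [_|[i j] E IH /=].
  rewrite (_ : partial_layer _ _ _ = \prod_(i in I) prime_var S i).
    by rewrite subrr; apply: PrimeDeg0.
  rewrite /partial_layer (eq_bigl (fun U : {set 'I_n} => U \in {set 'I_n})) // -bigA_distr.
  rewrite [RHS]big_mkcond; apply: eq_bigr => i _; rewrite /inside /outside !inE.
  case: (i \in I) => //=; last by rewrite add0r.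
  by rewrite /half_prime prime_varE /exch addrC mulrDr.
case/andP=> /and3P[iI jI ij] EI; rewrite partial_layer_cons //= addrAC.
apply: pdegB; first exact: IH.
apply: (@pdeg_le (#|I :\: ((i |: set0) :|: (j |: set0))|.+1)).
  rewrite !setU0 (cardsD1 i I) iI /= add1n ltnS; apply: subset_leq_card.
  by apply/subsetP => l; rewrite !inE negb_or => /andP[/andP[-> _] ->].
apply: pdeg_partial => //; split.
- by rewrite setU0 sub1set.
- by rewrite setU0 sub1set.
- by move=> l; rewrite setU0 inE => /eqP->; exists j; rewrite ?setU11.
- by move=> l; rewrite setU0 inE => /eqP->; exists i; rewrite ?setU11.
Qed.

(** Dropping the compatibility condition changes a layer by terms of lower degree
    in the primed variables: for a violated arrow [i -> j], the monomial chosen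
    at [i] contains [x_j] and the one chosen at [j] contains [x_i], so
    neither contributes a denominator. *)
Lemma layer_leading :
  prime_deg_lt #|I| (layer S I - \prod_(i in I) prime_var S i).
Proof.
pose E := [seq e <- index_enum ('I_n * 'I_n)%type |
  [&& e.1 \in I, e.2 \in I & 0 < b (lshift k e.1) e.2]].
have EI : all (fun e => [&& e.1 \in I, e.2 \in I & 0 < b (lshift k e.1) e.2]) E.
  exact: filter_all.
suff -> : layer S I = partial_layer E set0 set0 by exact: pdeg_partial_sub.
have allE U : all (comp U) E = gcc S I U.
  apply/allP/forall_inP => [h i iI|h [i j]].
    apply/forall_inP => j jI; apply/implyP => ij; apply: (h (i, j)).
    by rewrite mem_filter /= iI jI -arrowE ij mem_index_enum.
  rewrite mem_filter => /andP[/and3P[/= iI jI]]; rewrite -arrowE => ij _.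
  by have /forall_inP/(_ j jI)/implyP/(_ ij) := h i iI.
rewrite /layer /partial_layer [RHS](bigID (fun U : {set 'I_n} => U \subset I)) /=.
rewrite [X in _ = _ + X]big1 ?addr0 => [|U /andP[_ /subsetPn[i iU iI]]]; last first.
  by rewrite (bigD1 i) //= iU /inside (negbTE iI) mul0r.
apply: eq_big => [U|U /andP[/subsetP UI _]]; first by rewrite allE andbC.
rewrite big_mkcond; apply: eq_bigr => i _; rewrite /inside /outside !inE andbT.
case: (boolP (i \in U)) => iU; first by rewrite UI.
by [].
Qed.

End LayerDegree.

Definition xtilde_deg (a : {ffun 'I_n -> int}) := (\sum_l absz (pos (a l)))%N.

Definition standard_monomial (a : {ffun 'I_n -> int}) :=
  xmono (fun l => absz (pos (- a l))) * pmono (fun l => absz (pos (a l))).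

Lemma xtilde_leading a :
  prime_deg_lt (xtilde_deg a) (xtilde S a - standard_monomial a).
Proof.
pose D := (\max_l absz (pos (a l)))%N.
have aD l : (absz (pos (a l)) <= D)%N by apply: leq_bigmax.
have count l : (\sum_(r < D) (l \in level a r) = absz (pos (a l)))%N.
  transitivity (\sum_(r < absz (pos (a l))) 1)%N; last by rewrite sum1_card card_ord.
  rewrite [RHS](big_ord_widen D (fun=> 1%N) (aD l)) [RHS]big_mkcond.
  by apply: eq_bigr => r _; rewrite inE; case: ifP.
rewrite (xtilde_layers indep sS aD) /standard_monomial.
have -> : pmono (fun l => absz (pos (a l))) =
    \prod_(r < D) \prod_(l in level a r) prime_var S l.
  rewrite (exchange_big_dep xpredT) //=; apply: eq_bigr => l _.
  rewrite prodr_const; congr (_ ^+ _); rewrite -count -sum1_card [RHS]big_mkcond.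
  by apply: eq_bigr => r _.
have -> : \prod_l x (lshift k l) ^ pos (- a l) = xmono (fun l => absz (pos (- a l))).
  by apply: eq_bigr => l _; rewrite exprnP; congr (_ ^ _); have := pos_ge0 (- a l); lia.
rewrite -mulrBr -[xtilde_deg a]add0n; apply: pdegM.
  rewrite -[xmono _]mulr1 -pmono0 -[X in prime_deg_lt _ X]mul1r.
  by apply: PrimeDegMono; [apply: Subring_one | rewrite big1].
have <- : (\sum_(r < D) #|level a r| = xtilde_deg a)%N.
  rewrite /xtilde_deg (eq_bigr (fun r : 'I_D => \sum_l (l \in level a r : nat))%N).
    by rewrite exchange_big; apply: eq_bigr => l _; rewrite count.
  by move=> r _; rewrite sum_mem.
have [] // := @pdeg_prod _ (index_enum 'I_D) (fun r => #|level a r|)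
  (fun r => \prod_(l in level a r) prime_var S l) (fun r => layer S (level a r)).
- by move=> r; apply: pdeg_primes.
- by move=> r; apply: layer_leading.
Qed.

Definition spanned (z : ratfun (n + k)) :=
  exists (s : seq {ffun 'I_n -> int}) (c : {ffun 'I_n -> int} -> ratfun (n + k)),
    [/\ uniq s, forall a, ZP S (c a) & z = \sum_(a <- s) c a * xtilde S a].

Lemma spanned0 : spanned 0.
Proof.
by exists [::], (fun=> 0); split=> // [_|]; [exact: (subring_gen0 _) | rewrite big_nil].
Qed.

Lemma spannedD y z : spanned y -> spanned z -> spanned (y + z).
Proof.
case=> s [c [us Zc ->]] [s' [c' [us' Zc' ->]]].
pose t := undup (s ++ s').
pose e (r : seq {ffun 'I_n -> int}) (d : {ffun 'I_n -> int} -> ratfun (n + k)) a :=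
  if a \in r then d a else 0.
have E r d : uniq r -> {subset r <= t} ->
    \sum_(a <- r) d a * xtilde S a = \sum_(a <- t) e r d a * xtilde S a.
  move=> ur rt; rewrite [RHS](bigID (mem r)) /= [X in _ + X]big1 ?addr0; last first.
    by move=> a /negbTE ar; rewrite /e ar mul0r.
  rewrite -[RHS]big_filter; rewrite (perm_big [seq a <- t | a \in r]).
    by rewrite !big_filter; apply: eq_bigr => a ar; rewrite /e ar.
  apply: uniq_perm => //; first by rewrite filter_uniq ?undup_uniq.
  by move=> a; rewrite mem_filter; case: (boolP (a \in r)) => //= /rt->.
exists t, (fun a => e s c a + e s' c' a); split; first exact: undup_uniq.
  by move=> a; apply: subring_genD; rewrite /e; case: ifP => _;
    do ?[exact: Zc | exact: Zc' | exact: subring_gen0].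
rewrite (E s c) ?(E s' c') // -?big_split.
- by apply: eq_bigr => a _; rewrite mulrDl.
- by move=> a; rewrite mem_undup mem_cat orbC => ->.
- by move=> a; rewrite mem_undup mem_cat => ->.
Qed.

Lemma spanned_xtilde c a : ZP S c -> spanned (c * xtilde S a).
Proof. by move=> Zc; exists [:: a], (fun=> c); rewrite big_seq1; split. Qed.

(** A monomial containing some [x_l x_l'] has lower degree after an exchange
    relation; any other is a standard monomial, hence the leading part of a
    generator. *)
Lemma pdeg_spanned d z : prime_deg_lt d z -> spanned z.
Proof.
elim: d z => [|d IH] z.
  move Ed: 0%N => d h; elim: h Ed => {d z} [d|d y z _ IHy _ IHz|d c u v _ vd] Ed.
  - exact: spanned0.
  - by apply: spannedD; [apply: IHy | apply: IHz].
  - by rewrite -Ed in vd.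
move Ed: d.+1 => d' h; elim: h Ed => {d' z} [d'|d' y z _ IHy _ IHz|d' c u v Zc vd] Ed.
- exact: spanned0.
- by apply: spannedD; [apply: IHy | apply: IHz].
rewrite -Ed in vd.
have [/existsP[l /andP[ul vl]]|disj] := boolP [exists l, (0 < u l)%N && (0 < v l)%N].
  apply: IH; pose dl (i : 'I_n) : nat := i == l.
  have Eu : xmono u = xmono (fun i => u i - dl i)%N * x (lshift k l).
    rewrite -xmono1 -xmonoD; apply: eq_bigr => i _; congr (_ ^+ _).
    by rewrite subnK // /dl; case: eqP => // ->.
  have Ev : pmono v = pmono (fun i => v i - dl i)%N * prime_var S l.
    rewrite -pmono1 -pmonoD; apply: eq_bigr => i _; congr (_ ^+ _).
    by rewrite subnK // /dl; case: eqP => // ->.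
  have -> : c * (xmono u * pmono v) = exch S l *
      (c * (xmono (fun i => u i - dl i)%N * pmono (fun i => v i - dl i)%N)).
    by rewrite Eu Ev mulrACA prime_varE mulVKf // [RHS]mulrC [LHS]mulrA.
  rewrite -[d]add0n; apply: pdegM; first exact: pdeg_exch.
  apply: PrimeDegMono => //; move: vd.
  rewrite (bigD1 l) // [X in _ -> (X < _)%N](bigD1 l) //= /dl eqxx.
  have -> : (\sum_(i | i != l) (v i - (i == l)) = \sum_(i | i != l) v i)%N.
    by apply: eq_bigr => i /negbTE->; rewrite subn0.
  by move: vl; move: (\sum_(i | i != l) v i)%N (v l) => sv w /=; lia.
pose a : {ffun 'I_n -> int} := [ffun l => (v l)%:Z - (u l)%:Z].
have [Eu Ev] : (forall l, absz (pos (- a l)) = u l) /\ (forall l, absz (pos (a l)) = v l).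
  by split=> l; have := existsPn disj l; rewrite !ffunE /pos; lia.
have <- : standard_monomial a = xmono u * pmono v.
  by congr (_ * _); apply: eq_bigr => l _; rewrite ?Eu ?Ev.
rewrite -[standard_monomial a](subKr (xtilde S a)) mulrBr.
apply: spannedD; first exact: spanned_xtilde.
apply: IH; rewrite -mulN1r mulrA; apply: pdegZ.
  by apply: Subring_mul => //; apply: subring_genN; apply: Subring_one.
apply: pdeg_le (xtilde_leading a).
rewrite -ltnS; apply: leq_trans vd; rewrite ltnS leq_eqVlt; apply/orP; left.
by apply/eqP/eq_bigr => l _.
Qed.

Lemma xtilde_mixed a : mixed S setT (xtilde S a).
Proof.
rewrite -[xtilde S a](subrK (standard_monomial a)); apply: subring_genD.
  exact: pdeg_mixed (xtilde_leading a).
by apply: Subring_mul; apply: subring_gen_prod => l _; apply: subring_genX;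
  [apply: mixed_var | apply: mixed_prime].
Qed.

End Spanning.

(** * Initial forms and linear independence *)
Section Bottom.
Variables (F : fieldType) (m : nat) (x : 'I_m -> F) (w : 'I_m -> int).
Hypothesis indep : alg_indep x.
Local Notation homw := (homogeneous x w).
Let gw := hom_graded x w.

(** The initial form of [z] has degree [d]. It is tracked without being named, since
    only its degree and its being nonzero matter. *)
Definition has_bottom (d : int) (z : F) : Prop :=
  exists q : {poly F}, [/\ z = q.[1], forall i : nat, homw (d + i%:Z) q`_i & q`_0 != 0].

Lemma bottomM d e y z : has_bottom d y -> has_bottom e z -> has_bottom (d + e) (y * z).
Proof.
case=> p [-> hp p0] [q [-> hq q0]]; exists (p * q); split.
- by rewrite hornerM.
- move=> i; rewrite coefM; apply: gf_sum => // j _.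
  by have := gfM gw (hp j) (hq (i - j)%N); congr homogeneous; have := ltn_ord j; lia.
- by rewrite coefM big_ord1 mulf_neq0.
Qed.

Lemma bottom_hom d z : homw d z -> z != 0 -> has_bottom d z.
Proof.
move=> hz z0; exists z%:P; rewrite hornerC coefC eqxx; split=> // i.
by rewrite coefC; case: eqP => [->|_]; [rewrite addr0 | apply: (gf0 gw)].
Qed.

Lemma bottom_prod I (r : seq I) (d : I -> int) (f : I -> F) :
  (forall i, has_bottom (d i) (f i)) ->
  has_bottom (\sum_(i <- r) d i) (\prod_(i <- r) f i).
Proof.
move=> hf; elim/big_rec2: _ => [|i y e _ h]; last exact: bottomM.
by apply: bottom_hom; [apply: (gf1 gw) | apply: oner_neq0].
Qed.

(** The terms of lowest degree cannot cancel, because all coefficients are [1]. *)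
Lemma bottom_sum (I : finType) (P : pred I) (d : I -> int) (e : I -> 'I_m -> int) i0 :
  P i0 -> (forall i, P i -> d i0 <= d i) ->
  (forall i, P i -> homw (d i) (zmono x (e i))) ->
  has_bottom (d i0) (\sum_(i | P i) zmono x (e i)).
Proof.
move=> P0 dmin he.
exists (\sum_(i | P i) zmono x (e i) *: 'X^(absz (d i - d i0))); split.
- by rewrite horner_sum; apply: eq_bigr => i _; rewrite hornerZ hornerXn expr1n mulr1.
- move=> a; rewrite coef_sum; apply: gf_sum => // i Pi; rewrite coefZ coefXn.
  case: eqP => [->|_]; last by rewrite mulr0; apply: (gf0 gw).
  rewrite mulr1; have := he i Pi; congr homogeneous; have := dmin i Pi; lia.
rewrite coef_sum (bigID (fun i => d i == d i0)) /= [X in _ + X]big1 ?addr0; last first.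
  move=> i /andP[Pi di]; rewrite coefZ coefXn; case: eqP => [E|_]; last by rewrite mulr0.
  by have := dmin i Pi; lia.
rewrite (eq_bigr (fun i => zmono x (e i))) => [|i /andP[_ /eqP->]].
  by apply: sum_zmono_neq0 => //; exists i0; rewrite P0 eqxx.
by rewrite subrr coefZ coefXn mulr1.
Qed.

Lemma seq_argmin (I : eqType) (s : seq I) (d : I -> int) : s != [::] ->
  exists2 a, a \in s & forall c, c \in s -> d a <= d c.
Proof.
elim: s => // a [|a' s] IH _; first by exists a => [|c]; rewrite ?inE // => /eqP->.
have [c cs hc] := IH isT; have [h|h] := lerP (d a) (d c).
  exists a; rewrite ?inE ?eqxx // => e; rewrite inE => /orP[/eqP->//|es].
  by apply: le_trans h (hc e es).
exists c; first by rewrite inE cs orbT.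
by move=> e; rewrite inE => /orP[/eqP->|/hc//]; apply: ltW.
Qed.

(** Elements with distinct bottom degrees are independent over degree zero: the
    lowest bottom in a relation has nothing to cancel with. *)
Lemma bottom_independent (I : eqType) (s : seq I) (d : I -> int) (f c : I -> F) :
  uniq s -> (forall a, homw 0 (c a)) ->
  (forall a, a \in s -> has_bottom (d a) (f a)) ->
  {in s &, injective d} -> \sum_(a <- s) c a * f a = 0 ->
  forall a, a \in s -> c a = 0.
Proof.
have [N] := ubnP (size s); elim: N s => // N IH s sN us hc hf injd E.
have [->|s0] := eqVneq s [::]; first by [].
have [a0 a0s dmin] := seq_argmin d s0.
have pr : perm_eq s (a0 :: rem a0 s) := perm_to_rem a0s.
have a0r : a0 \notin rem a0 s by have := us; rewrite (perm_uniq pr) => /andP[].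
have sub a : a \in rem a0 s -> a \in s by move/mem_rem.
have [Q [EQ hQ Q0]] : exists Q : {poly F}, [/\ \sum_(a <- rem a0 s) c a * f a = Q.[1],
    forall i : nat, homw (d a0 + i%:Z) Q`_i & Q`_0 = 0].
  have : forall a, a \in rem a0 s -> a \in s /\ a != a0.
    by move=> a ar; split; [exact: sub | apply/eqP => Ea; rewrite Ea (negbTE a0r) in ar].
  elim: (rem a0 s) => [_|a r IHr hr].
    exists 0; rewrite big_nil horner0 coef0; split=> // i.
    by rewrite coef0; apply: (gf0 gw).
  have [|Q [EQ hQ Q0]] := IHr; first by move=> a' h; apply: hr; rewrite inE h orbT.
  have [as' aa0] := hr a (mem_head a r); have [q [Ef hq q0]] := hf a as'.
  have dlt : d a0 < d a.
    rewrite lt_neqAle dmin // andbT; apply: contra aa0 => /eqP Ed.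
    by apply/eqP/injd.
  exists (c a *: (q * 'X^(absz (d a - d a0))) + Q); split.
  - by rewrite big_cons EQ Ef hornerD hornerZ hornerM hornerXn expr1n mulr1.
  - move=> i; rewrite coefD coefZ coefMXn; apply: gfD => //.
    case: ltnP => h; first by rewrite mulr0; apply: (gf0 gw).
    by have := gfM gw (hc a) (hq (i - absz (d a - d a0))%N); congr homogeneous; lia.
  - by rewrite coefD Q0 addr0 coefZ coefMXn; case: ltnP => h; [rewrite mulr0 | lia].
have [q [Ef hq q0]] := hf a0 a0s.
have ca0 : c a0 = 0.
  have : c a0 *: q + Q = 0.
    apply: (hom_unique indep (w := w) (d := d a0)).
      move=> i; rewrite coefD coefZ; apply: gfD => //.
      by have := gfM gw (hc a0) (hq i); rewrite add0r.
    by rewrite hornerD hornerZ -Ef -EQ -[RHS]E (perm_big _ pr) big_cons.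
  move=> E0; have := congr1 (fun p : {poly F} => p`_0) E0.
  by rewrite coefD coefZ Q0 addr0 coef0 => /eqP; rewrite mulf_eq0 (negbTE q0) orbF => /eqP.
have rec : forall a, a \in rem a0 s -> c a = 0.
  apply: IH => //.
  - by rewrite size_rem //; case: (s) s0 sN.
  - exact: rem_uniq.
  - by move=> a /sub; apply: hf.
  - by move=> a a' /sub h /sub h'; apply: injd.
  - by rewrite -[RHS]E (perm_big _ pr) big_cons ca0 mul0r /= add0r.
by move=> a; rewrite (perm_mem pr) inE => /orP[/eqP->|/rec].
Qed.

End Bottom.

(** Powers of a large base: the first nonzero coordinate of each of finitely many
    vectors decides the sign of its product with the weight. *)
Lemma lexicographic_weight n (key : 'I_n -> nat) (V : seq {ffun 'I_n -> int}) :
  injective key -> exists W : 'I_n -> int, (forall i, 0 <= W i) /\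
    forall v, v \in V -> forall i0, 0 < v i0 ->
      (forall i, (key i < key i0)%N -> v i = 0) -> 0 < \sum_i W i * v i.
Proof.
(* [D] exceeds the sum of the absolute values of the coordinates of every vector. *)
move=> ikey; pose C : int := \sum_(v <- V) \sum_i `|v i|.
pose N := (\max_i key i)%N; pose D := C + 1.
have kN i : (key i <= N)%N by apply: leq_bigmax.
have sum_ge0 (v : {ffun 'I_n -> int}) : 0 <= \sum_i `|v i| by apply: sumr_ge0.
have C0 : 0 <= C by apply: sumr_ge0.
have D0 : 0 <= D by lia.
exists (fun i => D ^+ (N.+1 - key i)); split=> [i|v vV i0 vi0 v0]; first exact: exprn_ge0.
have vC : \sum_i `|v i| <= C by rewrite /C (big_rem v) //= lerDl; apply: sumr_ge0.
have [p Ep] : exists p, (N.+1 - key i0 = p.+1)%N by exists (N - key i0)%N; rewrite subSn.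
rewrite (bigD1 i0) //= Ep.
have lower : - (D ^+ p * \sum_(i | i != i0) `|v i|) <=
    \sum_(i | i != i0) D ^+ (N.+1 - key i) * v i.
  rewrite mulr_sumr -sumrN; apply: ler_sum => i ii0.
  have [lt|ge] := ltnP (key i) (key i0); first by rewrite v0 // normr0 !mulr0 oppr0.
  have lt : (key i0 < key i)%N.
    by rewrite ltn_neqAle ge andbT; apply: contra ii0 => /eqP/ikey->.
  apply: (@le_trans _ _ (- (D ^+ (N.+1 - key i) * `|v i|))).
    rewrite lerN2; apply: ler_wpM2r => //; apply: ler_weXn2l; lia.
  by rewrite -mulrN; apply: ler_wpM2l; [apply: exprn_ge0 | lia].
have rest : \sum_(i | i != i0) `|v i| < D.
  by rewrite ltzD1; apply: le_trans vC; rewrite [leRHS](bigD1 i0) //= lerDr.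
apply: (@lt_le_trans _ _ (D ^+ p.+1 * v i0 - D ^+ p * \sum_(i | i != i0) `|v i|)); last first.
  by rewrite lerD2l.
have Dp : 0 < D ^+ p by apply: exprn_gt0; lia.
rewrite exprSr -mulrA -mulrBr pmulr_rgt0 // subr_gt0; apply: lt_le_trans rest _.
by rewrite ler_peMr //; lia.
Qed.

Section Independence.
Variables (n k : nat) (S : preseed n k).
Hypotheses (indep : alg_indep (svar S)) (sS : sign_skew S) (aS : acyclic_on S setT).
Local Notation x := (svar S).
Local Notation b := (smat S).
Let x0 i : x i != 0 := alg_indep_neq0 indep i.

Lemma topological_order : exists key : 'I_n -> nat, injective key /\
  forall i j, 0 < b (lshift k i) j -> (key i < key j)%N.
Proof.
(* The index breaks ties between equal ranks. *)
case: aS => rk hrk; exists (fun i => (rk i * n + i)%N); split.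
  move=> i j E; apply: val_inj; rewrite /= -(modn_small (ltn_ord i)) -(modn_small (ltn_ord j)).
  by rewrite -(modnMDl (rk i)) E modnMDl.
move=> i j /(hrk _ _ (in_setT i) (in_setT j)) h; apply: (@leq_trans (rk i * n + n)).
  by rewrite ltn_add2l.
by rewrite -mulSnr; apply: leq_trans (leq_addr _ _); rewrite leq_mul2r h orbT.
Qed.

(** It decides which exchange monomial has the smaller degree: the outgoing one,
    whose variables come later, except at a vertex without incoming arrows, where
    the incoming one is a product of frozen variables. *)
Definition has_incoming l := [exists i, 0 < b (lshift k i) l].

Definition low_exponent l i : int :=
  pos (if has_incoming l then - b (lshift k i) l else b (lshift k i) l).

(** The exponent of the lowest part of [xtilde S a]; its coordinate at [i] is [- a i]
    plus a function of the values of [a] at the predecessors of [i]. *)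
Definition low_degree_vector (a : {ffun 'I_n -> int}) i : int :=
  - a i + \sum_l pos (a l) * low_exponent l i.

Lemma low_exponent_neq0 l i : low_exponent l i != 0 -> 0 < b (lshift k l) i.
Proof.
rewrite /low_exponent; case: ifP => [_|/negbT/existsPn/(_ i)].
  by have [[]|[]|[]] := sign_skew_pair l i sS; rewrite /pos; lia.
by rewrite -leNgt => h; rewrite pos_eq0 // eqxx.
Qed.

Section Weighted.
Variable W : 'I_n -> int.
Hypothesis W0 : forall i, 0 <= W i.
Hypothesis Wcol : forall l, has_incoming l -> 0 <= \sum_i W i * b (lshift k i) l.

Definition mutable_weight (r : 'I_(n + k)) : int := if split r is inl i then W i else 0.
Local Notation w := mutable_weight.

Lemma mutable_weight_sum (e : 'I_(n + k) -> int) :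
  \sum_r w r * e r = \sum_i W i * e (lshift k i).
Proof.
rewrite big_split_ord /= [X in _ + X]big1 ?addr0 => [|j _].
  by apply: eq_bigr => i _; rewrite /w split_lshift.
by rewrite /w split_rshift mul0r.
Qed.

Definition half_degree l (c : bool) :=
  \sum_i W i * pos (if c then - b (lshift k i) l else b (lshift k i) l) - W l.

Lemma half_degree_min l c : half_degree l (has_incoming l) <= half_degree l c.
Proof.
rewrite /half_degree lerD2r; case: (boolP (has_incoming l)) => hl; case: c => //.
  rewrite -subr_ge0 -sumrB (eq_bigr (fun i => W i * b (lshift k i) l)).
    exact: Wcol.
  by move=> i _; rewrite -mulrBr posE.
rewrite big1 => [|i _]; first by apply: sumr_ge0 => i _; apply: mulr_ge0 => //; apply: pos_ge0.
by have := existsPn hl i; rewrite -leNgt => h; rewrite pos_eq0 // mulr0.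
Qed.

Lemma half_prime_hom l c : homogeneous x w (half_degree l c) (half_prime S l c).
Proof.
rewrite (half_prime_zmono indep).
have := hom_zmono indep w (fun r => pos (if c then - b r l else b r l) - (r == lshift k l)%:Z).
rewrite mutable_weight_sum; congr homogeneous.
rewrite (eq_bigr _ (fun i _ => mulrBr _ _ _)) sumrB; congr (_ - _).
rewrite (bigD1 l) //= eqxx mulr1 big1 ?addr0 // => i il.
by rewrite (inj_eq (@lshift_inj _ _)) (negbTE il) mulr0.
Qed.

(** Choosing the monomial of smaller degree at every vertex is compatible: a vertex
    that takes the incoming monomial has no incoming arrow. *)
Lemma layer_bottom (I : {set 'I_n}) :
  has_bottom x w (\sum_(i in I) half_degree i (has_incoming i)) (layer S I).
Proof.
pose U0 := [set i in I | has_incoming i].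
pose ex (U : {set 'I_n}) := fun r : 'I_(n + k) => \sum_(i in I)
  (pos (if i \in U then - b r i else b r i) - (r == lshift k i)%:Z).
have E (U : {set 'I_n}) : \prod_(i in I) half_prime S i (i \in U) = zmono x (ex U).
  by rewrite zmono_prod //; apply: eq_bigr => i _; rewrite (half_prime_zmono indep).
rewrite /layer (eq_bigr _ (fun U _ => E U)).
have <- : \sum_(i in I) half_degree i (i \in U0) = \sum_(i in I) half_degree i (has_incoming i).
  by apply: eq_bigr => i iI; rewrite inE iI.
apply: (bottom_sum indep (d := fun U : {set 'I_n} => \sum_(i in I) half_degree i (i \in U))).
- apply/andP; split; first by apply/subsetP => i; rewrite inE => /andP[].
  apply/forall_inP => i iI; apply/forall_inP => j jI; apply/implyP; rewrite arrowE => ij.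
  rewrite !inE jI negb_and /=; apply/orP; right; rewrite negbK.
  by apply/existsP; exists i.
- by move=> U _; apply: ler_sum => i iI; rewrite inE iI; apply: half_degree_min.
- move=> U _; rewrite -E; elim/big_rec2: _ => [|i d z iI h].
    exact: (gf1 (hom_graded x w)).
  exact: (gfM (hom_graded x w) (half_prime_hom i (i \in U)) h).
Qed.

Lemma xtilde_bottom (a : {ffun 'I_n -> int}) :
  has_bottom x w (\sum_i W i * low_degree_vector a i) (xtilde S a).
Proof.
pose D := (\max_l absz (pos (a l)))%N.
have aD l : (absz (pos (a l)) <= D)%N by apply: leq_bigmax.
rewrite (xtilde_layers indep sS aD).
have hx : has_bottom x w (\sum_l W l * pos (- a l)) (\prod_l x (lshift k l) ^ pos (- a l)).
  apply: bottom_prod => // l; apply: bottom_hom; last exact: expfz_neq0.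
  by have := homXz indep (pos (- a l)) (hom_var x w (lshift k l)); rewrite /w split_lshift.
have hl : has_bottom x w (\sum_(r < D) \sum_(i in level a r) half_degree i (has_incoming i))
    (\prod_(r < D) layer S (level a r)).
  by apply: bottom_prod => // r; apply: layer_bottom.
have := bottomM hx hl; congr has_bottom.
rewrite (exchange_big_dep xpredT) //=.
have -> : \sum_l \sum_(r < D | l \in level a r) half_degree l (has_incoming l) =
    \sum_l pos (a l) * half_degree l (has_incoming l).
  apply: eq_bigr => l _; rewrite sumr_const.
  rewrite (_ : #|_| = absz (pos (a l))).
    by rewrite -mulr_natl; congr (_ * _); have := pos_ge0 (a l); lia.
  rewrite -sum1_card -[RHS]card_ord -sum1_card [RHS](big_ord_widen D (fun=> 1%N) (aD l)).
  by apply: eq_bigl => r; rewrite -[LHS]/(l \in level a r) inE.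
rewrite -big_split /= /low_degree_vector.
rewrite [RHS](eq_bigr (fun i => W i * - a i + \sum_l W i * (pos (a l) * low_exponent l i))).
  rewrite [RHS]big_split /= [X in _ = _ + X]exchange_big /= -[RHS]big_split /=.
  apply: eq_bigr => l _.
  rewrite /half_degree mulrBr addrCA addrC; congr (_ + _).
    by rewrite -[a l in RHS]posE; ring.
  by rewrite mulr_sumr; apply: eq_bigr => i _; rewrite mulrCA.
by move=> i _; rewrite mulrDr mulr_sumr.
Qed.

End Weighted.

Lemma first_difference (key : 'I_n -> nat) (P : pred 'I_n) i : P i ->
  exists2 i0, P i0 & forall j, (key j < key i0)%N -> ~~ P j.
Proof.
move=> Pi; case: (arg_minnP key Pi) => i0 Pi0 min; exists i0 => // j; apply: contraTN.
by move=> /min; rewrite -leqNgt.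
Qed.

Lemma ZP_hom W c : ZP S c -> homogeneous x (mutable_weight W) 0 c.
Proof.
have g := hom_graded x (mutable_weight W).
have hr j : homogeneous x (mutable_weight W) 0 (x (rshift n j)).
  by have := hom_var x (mutable_weight W) (rshift n j); rewrite /mutable_weight split_rshift.
elim=> {c} [z [j [->|->]]||y z _ ? _ ?|y z _ ? _ ?].
- exact: hr.
- by have := homV indep (hr j); rewrite oppr0.
- exact: (gf1 g).
- exact: (gfB g).
- by rewrite -[0]addr0; apply: (gfM g).
Qed.

(** The first coordinate, along the arrows, where the lowest exponents of [xtilde S a]
    and [xtilde S a'] differ is the first one where [a] and [a'] differ. A weight
    that follows the lexicographic order therefore separates their degrees. *)
Theorem xtilde_independent (s : seq {ffun 'I_n -> int})
    (c : {ffun 'I_n -> int} -> ratfun (n + k)) :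
  uniq s -> (forall a, ZP S (c a)) -> \sum_(a <- s) c a * xtilde S a = 0 ->
  forall a, a \in s -> c a = 0.
Proof.
move=> us Zc; have [key [ikey hkey]] := topological_order.
pose col l : {ffun 'I_n -> int} := [ffun i => b (lshift k i) l].
pose diff (p : {ffun 'I_n -> int} * {ffun 'I_n -> int}) : {ffun 'I_n -> int} :=
  [ffun i => low_degree_vector p.1 i - low_degree_vector p.2 i].
have [W [W0 hW]] := lexicographic_weight
  ([seq col l | l <- enum 'I_n] ++ [seq diff p | p <- [seq (a, a') | a <- s, a' <- s]]) ikey.
have Wcol l : has_incoming l -> 0 <= \sum_i W i * b (lshift k i) l.
  case/existsP=> i1 hi1; apply: ltW.
  have b1 : b (lshift k i1) l != 0 by lia.
  have [i0 bi0 min] := first_difference key (P := fun i => b (lshift k i) l != 0) b1.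
  have := hW (col l) _ i0; rewrite mem_cat map_f ?mem_enum // => /(_ isT).
  under [X in _ -> _ -> 0 < X]eq_bigr do rewrite ffunE.
  apply; last by move=> i /min; rewrite negbK ffunE => /eqP.
  rewrite ffunE lt0r bi0 leNgt; apply/negP => neg.
  have lt1 := hkey _ _ hi1.
  have lt2 : (key l < key i0)%N.
    by apply: hkey; have [[]|[]|[]] := sign_skew_pair i0 l sS; lia.
  have := min i1 (ltn_trans lt1 lt2); rewrite negbK => /eqP; lia.
apply: (bottom_independent indep (w := mutable_weight W)
  (d := fun a => \sum_i W i * low_degree_vector a i)) => //.
- by move=> a; apply: ZP_hom.
- by move=> a _; apply: xtilde_bottom.
move=> a a' as_ as' E; apply/eqP; apply: contraT => aa'.
have [i1 hi1] : exists i, a i != a' i.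
  apply/existsP; apply: contraT => /existsPn h; case/eqP: aa'.
  by apply/ffunP => i; have := h i; rewrite negbK => /eqP.
have [i0 ai0 min] := first_difference key (P := fun i => a i != a' i) hi1.
have agree l : (key l < key i0)%N -> a l = a' l by move/min; rewrite negbK => /eqP.
have Elow i : (key i <= key i0)%N ->
    low_degree_vector a i - low_degree_vector a' i = a' i - a i.
  move=> ii0; rewrite /low_degree_vector.
  rewrite (eq_bigr (fun l => pos (a' l) * low_exponent l i)); first by ring.
  move=> l _; have [->|/low_exponent_neq0/hkey li] := eqVneq (low_exponent l i) 0.
    by rewrite !mulr0.
  by rewrite agree //; apply: leq_trans li ii0.
have key_step a1 a2 : a1 \in s -> a2 \in s ->
    0 < low_degree_vector a1 i0 - low_degree_vector a2 i0 ->
    (forall i, (key i < key i0)%N -> low_degree_vector a1 i - low_degree_vector a2 i = 0) ->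
    \sum_i W i * low_degree_vector a2 i < \sum_i W i * low_degree_vector a1 i.
  move=> s1 s2 h1 h2; rewrite -subr_gt0 -sumrB.
  have Ed i : diff (a1, a2) i = low_degree_vector a1 i - low_degree_vector a2 i.
    by rewrite /diff ffunE.
  have dV : diff (a1, a2) \in [seq col l | l <- enum 'I_n] ++
      [seq diff p | p <- [seq (a, a') | a <- s, a' <- s]].
    by rewrite mem_cat orbC map_f //; apply/allpairsP; exists (a1, a2).
  rewrite (eq_bigr (fun i => W i * diff (a1, a2) i)); last first.
    by move=> i _; rewrite Ed mulrBr.
  by apply: (hW _ dV i0) => [|i /h2]; rewrite Ed.
have z i : (key i < key i0)%N -> a' i - a i = 0 by move/agree->; rewrite subrr.
have [lt|lt] := ltrP (a i0) (a' i0).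
  suff : \sum_i W i * low_degree_vector a' i < \sum_i W i * low_degree_vector a i.
    by rewrite E ltxx.
  apply: key_step => //; first by rewrite Elow //; lia.
  by move=> i ii0; rewrite Elow ?z // ltnW.
suff : \sum_i W i * low_degree_vector a i < \sum_i W i * low_degree_vector a' i.
  by rewrite E ltxx.
apply: key_step => //; first by have := Elow i0 (leqnn _); lia.
by move=> i ii0; have := Elow i (ltnW ii0); have := z i ii0; lia.
Qed.

End Independence.

(** * The cluster algebra of an acyclic seed *)
Section MutationClass.
Variables (n k : nat).
Implicit Type S : preseed n k.

Lemma mutates_regular S ls :
  alg_indep (svar S) -> sign_skew S -> always_sign_skew S ->
  [/\ alg_indep (svar (mutates S ls)), sign_skew (mutates S ls) & always_sign_skew (mutates S ls)].
Proof.
elim: ls S => [|l ls IH] S hx sS tS //=; apply: IH.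
- exact: mutate_indep.
- exact: always_sign_skew1.
- exact: always_sign_skewS.
Qed.

Lemma mutates_cat S ls ls' : mutates S (ls ++ ls') = mutates (mutates S ls) ls'.
Proof. exact: foldl_cat. Qed.

Lemma mutates_revK S ls : alg_indep (svar S) -> sign_skew S -> always_sign_skew S ->
  mutates (mutates S ls) (rev ls) = S.
Proof.
elim: ls S => [|l ls IH] S hx sS tS //=.
rewrite rev_cons -cats1 mutates_cat IH /=.
- exact: mutateK.
- exact: mutate_indep.
- exact: always_sign_skew1.
- exact: always_sign_skewS.
Qed.

Lemma mutates_frozen S ls j : svar (mutates S ls) (rshift n j) = svar S (rshift n j).
Proof. by elim: ls S => [|l ls IH] S //=; rewrite IH mutate_frozen. Qed.

Lemma ZP_mutates S ls z : ZP (mutates S ls) z <-> ZP S z.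
Proof.
by split; apply: subring_gen_sub => {}z [j zj]; apply: Subring_gen; exists j;
  rewrite mutates_frozen in zj *.
Qed.

End MutationClass.

(** Mutations are invertible, so every seed of the algebra is reached from the acyclic
    one. *)
Theorem cluster_algebra_lower_bound (n k : nat) (S0 : preseed n k) (ls : seq 'I_n) z :
  alg_indep (svar S0) -> sign_skew S0 -> always_sign_skew S0 -> acyclic_seed (mutates S0 ls) ->
  cluster_algebra S0 z <-> mixed (mutates S0 ls) setT z.
Proof.
move=> hx0 s0 t0 aS; have [hx sS tS] := mutates_regular ls hx0 s0 t0.
have aT := acyclic_seed_rank aS.
split; apply: subring_gen_sub => {}z.
  case=> [|[S' [ls' [_ ->]] [i ->]]].
    move/(ZP_mutates S0 ls); apply: subring_gen_sub => {}z [j [->|->]].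
      exact: mixed_var.
    by apply: mixed_inv => l _; rewrite eq_rlshift.
  rewrite -{2}(mutates_revK ls hx0 s0 t0) -mutates_cat.
  exact: cluster_variable_lower.
have var i : cluster_algebra S0 (svar (mutates S0 ls) i).
  rewrite -(splitK i); case: (split i) => j /=.
    apply: Subring_gen; right; exists (mutates S0 ls); last by exists j.
    by exists ls.
  apply: Subring_gen; left; apply: Subring_gen; exists j; left.
  exact: mutates_frozen.
case=> [[i ->]|[i h ->]|[l _ ->]]; first exact: var.
  rewrite -(splitK i) in h *; case: (split i) h => j /= h.
    by have := h j (in_setT j); rewrite eqxx.
  apply: Subring_gen; left; apply: Subring_gen; exists j; right.
  by rewrite mutates_frozen.
apply: Subring_gen; right; exists (mutates S0 (ls ++ [:: l])).
  by exists (ls ++ [:: l]).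
by exists l; rewrite mutates_cat.
Qed.

Theorem theorem1p2 (n k : nat) (hn : (1 <= n)%N) (S0 S : preseed n k)
  (seed0 : is_seed S0) (mutable0 : totally_mutable S0)
  (acyclicA : acyclic_cluster_algebra S0)
  (equivS : mutation_equivalent S0 S) (acyclicS : acyclic_seed S) :
  is_basis (ZP S0) (cluster_algebra S0)
    (fun a : {ffun 'I_n -> int} => xtilde S a).
Proof.
case: equivS acyclicS => ls [_ ->{S}] aS; case: seed0 => /free_generating_indep hx0 s0.
have [hx sS _] := mutates_regular ls hx0 s0 mutable0.
have lower z := cluster_algebra_lower_bound z hx0 s0 mutable0 aS.
split.
- by move=> a; apply/lower/xtilde_mixed.
- move=> s c us Zc; apply: xtilde_independent => //; first exact: acyclic_seed_rank.
  by move=> a; apply/ZP_mutates.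
- move=> z /lower/mixed_pdeg[d /(pdeg_spanned hx sS)[s [c [us Zc ->]]]].
  by exists s, c; split=> // a; apply/(ZP_mutates S0 ls).
Qed.
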